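(* Let $A$ be a factorizable ribbon Hopf algebra with ribbon element $v$ and nonzero right integral $\rho$, and let $\mathfrak S^n,\mathfrak T^n$ be the cochain automorphisms of the Hochschild cochain complex $C(A,A)$ defined below. Then: (1) $\mathfrak S^n\circ\mathfrak T^n\circ\mathfrak S^n=\rho(v)\,(\mathfrak T^n)^{-1}\circ\mathfrak S^n\circ(\mathfrak T^n)^{-1}$ for all $n$; (2) the cochain map with components $(\mathfrak S^n)^4$ is cochain homotopic to the cochain map with components $\big((\rho\otimes\rho)(Q)\big)^2\,\mathrm{id}_{C^n(A,A)}$.
   Context: $A$ is a finite-dimensional Hopf algebra over a field $K$ with coproduct $\Delta(a)=a_{(1)}\otimes a_{(2)}$ (iterated: $a_{(1)}\otimes a_{(2)}\otimes a_{(3)}$), counit $\varepsilon$, bijective antipode $S$, quasitriangular with R-matrix $R=R_1\otimes R_2$ (invertible, $\Delta^{\mathrm{cop}}(a)=R\Delta(a)R^{-1}$, $(\Delta\otimes\mathrm{id})(R)=R_{13}R_{23}$, $(\mathrm{id}\otimes\Delta)(R)=R_{13}R_{12}$), monodromy matrix $Q=\tau(R)R=R_2R'_1\otimes R_1R'_2=Q_1\otimes Q_2$, Drinfel'd element $u=S(R_2)R_1$, and ribbon element $v$ in the convention: $v$ central invertible, $S(v)=v$, $\varepsilon(v)=1$, $v^2=(uS(u))^{-1}$, $\Delta(v)=(v\otimes v)Q$. Factorizable: $\bar\Phi\colon A^*\to A$, $\varphi\mapsto\varphi(Q_1)Q_2$, is bijective. $\rho\in A^*$ is a nonzero right integral ($\rho(a_{(1)})a_{(2)}=\rho(a)1_A$),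 and $\iota\colon A\to A^*$, $\iota(a)(b)=\rho(ab)$. Hochschild cochain complex $C(A,A)$: $C^n(A,A)=\mathrm{Hom}_K(A^{\otimes n},A)$ ($C^0=A$, $C^n=0$ for $n<0$), differential $d^{n-1}(f)(a_1\otimes\cdots\otimes a_n)=a_1f(a_2\otimes\cdots\otimes a_n)+\sum_{i=1}^{n-1}(-1)^if(a_1\otimes\cdots\otimes a_ia_{i+1}\otimes\cdots\otimes a_n)+(-1)^nf(a_1\otimes\cdots\otimes a_{n-1})a_n$. Define $\mathfrak T^n(f)(a_1\otimes\cdots\otimes a_n)=v\,f(a_1\otimes\cdots\otimes a_n)$ and $\mathfrak S^n:=S^n\circ\bar\Phi^n\circ\iota^n$, where $\iota^n(f)=\iota\circ f$; for $g\in\mathrm{Hom}_K(A^{\otimes n},A^* )$, $\bar\Phi^n(g)(a_1\otimes\cdots\otimes a_n)=g(a_{1(2)}\otimes\cdots\otimes a_{n(2)})\big(Q_1S^{-1}(a_{n(1)})\cdots S^{-1}(a_{1(1)})\big)a_{1(3)}\cdots a_{n(3)}Q_2$; for $h\in\mathrm{Hom}_K(A^{\otimes n},A)$, $S^n(h)(a_1\otimes\cdots\otimes a_n)=a_{1(1)}\cdots a_{n(1)}S\big(h(a_{1(2)}\otimes\cdots\otimes a_{n(2)})\big)a_{1(3)}\cdots a_{n(3)}$ (empty products are $1$ for $n=0$). Equivalently, $\mathfrak S^n(f)(a_1\otimes\cdots\otimes a_n)=\rho\big(S(a_{n(2)})\cdots S(a_{1(2)})f(a_{1(3)}\otimes\cdots\otimes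 a_{n(3)})Q_1\big)a_{1(1)}\cdots a_{n(1)}S(Q_2)$. These $\mathfrak S^n,\mathfrak T^n$ are components of cochain automorphisms of $C(A,A)$. *)

(* Defs.v *)
(* Finite-dimensional (ribbon, factorizable) Hopf algebras,
   modelled concretely: A is a finite-dimensional K-algebra (falgType K), tensor
   powers of A are modelled via coordinates in the basis b := vbasis {:A}.     *)
From HB Require Import structures.
From mathcomp Require Import all_boot all_algebra all_field.
Set Implicit Arguments. Unset Strict Implicit. Unset Printing Implicit Defensive.
Import GRing.Theory.
Local Open Scope ring_scope.

Section HopfDefs.
Variables (K : fieldType) (A : falgType K).

Definition dimA : nat := \dim (fullv : {vspace A}).
Definition bas : dimA.-tuple A := vbasis (fullv : {vspace A}).
Definition bv (i : 'I_dimA) : A := tnth bas i.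
Definition crd (i : 'I_dimA) (x : A) : K := coord bas i x.

(* A (x) A and A (x) A (x) A, as coefficient arrays w.r.t. the basis b_i (x) b_j
   (resp. b_i (x) b_j (x) b_k). *)
Definition T2 := {ffun 'I_dimA * 'I_dimA -> K^o}.
Definition T3 := {ffun 'I_dimA * 'I_dimA * 'I_dimA -> K^o}.

Definition pt2 (x y : A) : T2 := [ffun p => crd p.1 x * crd p.2 y].
Definition pt3 (x y z : A) : T3 :=
  [ffun p => crd p.1.1 x * crd p.1.2 y * crd p.2 z].

(* universal property: the linear map A(x)A -> V induced by a bilinear F *)
Definition Ev2 (V : lmodType K) (F : A -> A -> V) (t : T2) : V :=
  \sum_(p : 'I_dimA * 'I_dimA) (t p : K) *: F (bv p.1) (bv p.2).
Definition Ev3 (V : lmodType K) (F : A -> A -> A -> V) (t : T3) : V :=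
  \sum_(p : 'I_dimA * 'I_dimA * 'I_dimA)
     (t p : K) *: F (bv p.1.1) (bv p.1.2) (bv p.2).

Definition tmul2 (s t : T2) : T2 :=
  Ev2 (fun x y => Ev2 (fun x' y' => pt2 (x * x') (y * y')) t) s.
Definition tmul3 (s t : T3) : T3 :=
  Ev3 (fun x y z => Ev3 (fun x' y' z' => pt3 (x * x') (y * y') (z * z')) t) s.
Definition one2 : T2 := pt2 1 1.
Definition flip2 (t : T2) : T2 := Ev2 (fun x y => pt2 y x) t.

Section Data.
Variables (Delta : A -> T2) (eps : A -> K) (S Sinv : A -> A) (R : T2) (v : A)
          (rho : A -> K).

Definition DeltaL (t : T2) : T3 := Ev2 (fun x y => Ev2 (fun x1 x2 => pt3 x1 x2 y) (Delta x)) t.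
Definition DeltaR (t : T2) : T3 := Ev2 (fun x y => Ev2 (fun y1 y2 => pt3 x y1 y2) (Delta y)) t.
Definition Delta3 (a : A) : T3 := DeltaL (Delta a).

Definition is_Hopf_algebra : Prop :=
  [/\ [/\ linear Delta, scalar eps & linear S],
      (forall a, DeltaL (Delta a) = DeltaR (Delta a)),
      (forall a c, Delta (a * c) = tmul2 (Delta a) (Delta c)) /\ Delta 1 = one2,
      (forall a c, eps (a * c) = eps a * eps c) /\ eps 1 = 1
    & (forall a, Ev2 (fun x y => eps x *: y) (Delta a) = a /\
                 Ev2 (fun x y => eps y *: x) (Delta a) = a)
      /\ (forall a, Ev2 (fun x y => S x * y) (Delta a) = eps a *: 1 /\
                 Ev2 (fun x y => x * S y) (Delta a) = eps a *: 1)].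

Definition is_inverse_antipode : Prop := cancel S Sinv /\ cancel Sinv S.

Definition R13 : T3 := Ev2 (fun x y => pt3 x 1 y) R.
Definition R23 : T3 := Ev2 (fun x y => pt3 1 x y) R.
Definition R12 : T3 := Ev2 (fun x y => pt3 x y 1) R.

Definition is_quasitriangular : Prop :=
  [/\ exists Rinv : T2,
        [/\ tmul2 R Rinv = one2, tmul2 Rinv R = one2 &
            forall a, flip2 (Delta a) = tmul2 (tmul2 R (Delta a)) Rinv],
      DeltaL R = tmul3 R13 R23
    & DeltaR R = tmul3 R13 R12].

Definition Qm : T2 := tmul2 (flip2 R) R.
Definition drinfeld_u : A := Ev2 (fun x y => S y * x) R.

Definition is_ribbon_element : Prop :=
  [/\ (forall a, v * a = a * v), v \is a GRing.unit, (S v = v /\ eps v = 1),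
      v ^+ 2 = (drinfeld_u * S drinfeld_u)^-1
    & Delta v = tmul2 (pt2 v v) Qm].

Definition Phibar (phi : A -> K) : A := Ev2 (fun x y => phi x *: y) Qm.

Definition is_factorizable : Prop :=
  (forall phi psi : A -> K, scalar phi -> scalar psi ->
       Phibar phi = Phibar psi -> forall a, phi a = psi a) /\
  (forall a, exists phi : A -> K, scalar phi /\ Phibar phi = a).

Definition is_nonzero_right_integral : Prop :=
  [/\ scalar rho, (exists a, rho a != 0)
    & forall a, Ev2 (fun x y => rho x *: y) (Delta a) = rho a *: 1].

(* C^n(A,A) = Hom_K(A^{(x)n}, A), determined by values on basis tensors
   b_{i_1} (x) ... (x) b_{i_n}. *)
Definition Coch (n : nat) := {ffun n.-tuple 'I_dimA -> A}.

Definition bseq n (idx : n.-tuple 'I_dimA) : seq A := map bv idx.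

Definition cev n (f : Coch n) (s : seq A) : A :=
  \sum_(idx : n.-tuple 'I_dimA)
     (\prod_(m < n) crd (tnth idx m) (nth 0 s m)) *: f idx.
Definition cevD n (g : {ffun n.-tuple 'I_dimA -> (A -> K)}) (s : seq A) (x : A) : K :=
  \sum_(idx : n.-tuple 'I_dimA)
     (\prod_(m < n) crd (tnth idx m) (nth 0 s m)) * g idx x.

(* multi-Sweedler: given a_1..a_n, sum over a_{i(1)} (x) a_{i(2)} (x) a_{i(3)}
   of F [a_{1(1)};..;a_{n(1)}] [a_{1(2)};..] [a_{1(3)};..]  *)
Fixpoint sw3 (V : lmodType K) (s : seq A) (F : seq A -> seq A -> seq A -> V) : V :=
  match s with
  | [::] => F [::] [::] [::]
  | a :: s' => Ev3 (fun x y z => sw3 s' (fun l1 l2 l3 => F (x :: l1) (y :: l2) (z :: l3)))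
                   (Delta3 a)
  end.

Definition prodl (l : seq A) : A := foldr (fun x y => x * y) 1 l.

Definition mergeAt (j : nat) (s : seq A) : seq A :=
  take j s ++ (nth 0 s j * nth 0 s j.+1) :: drop j.+2 s.
Definition hdiff n (f : Coch n) : Coch n.+1 :=
  [ffun idx => let s := bseq idx in
     nth 0 s 0 * cev f (behead s)
     + \sum_(j < n) (-1) ^+ j.+1 * cev f (mergeAt j s)
     + (-1) ^+ n.+1 * (cev f (take n s) * nth 0 s n)].

Definition iotan n (f : Coch n) : {ffun n.-tuple 'I_dimA -> (A -> K)} :=
  [ffun idx => fun x => rho (f idx * x)].
Definition Phin n (g : {ffun n.-tuple 'I_dimA -> (A -> K)}) : Coch n :=
  [ffun idx => sw3 (bseq idx) (fun l1 l2 l3 =>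
      Ev2 (fun q1 q2 => cevD g l2 (q1 * prodl (rev (map Sinv l1))) *: (prodl l3 * q2)) Qm)].
Definition Sn n (h : Coch n) : Coch n :=
  [ffun idx => sw3 (bseq idx) (fun l1 l2 l3 => prodl l1 * S (cev h l2) * prodl l3)].

Definition frakS n (f : Coch n) : Coch n := Sn (Phin (iotan f)).
Definition frakT n (f : Coch n) : Coch n := [ffun idx => v * f idx].
Definition frakTinv n (f : Coch n) : Coch n := [ffun idx => v^-1 * f idx].

Definition rhorhoQ : K := Ev2 (fun x y => (rho x * rho y : K^o)) Qm.

End Data.
End HopfDefs.

(* Main.v *)
Require Import Defs.
From HB Require Import structures.
From mathcomp Require Import all_boot all_algebra all_field.
Import GRing.Theory ssrAC.
Local Open Scope ring_scope.
Set Implicit Arguments. Unset Strict Implicit. Unset Printing Implicit Defensive.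

(** Put w = v^-1, [act x m] = x_(2) m S^-1(x_(1)), and let [fourier] be frakS in degree 0.
    Untwisting a cochain, f |-> f(a_(2)) S^-1(a_(1)) with a_(1) the product of the first
    Sweedler components, turns frakS^n into composition with [fourier] and C(A,A) into the
    Hochschild complex of A with left action [act] and trivial right action.  So (1) only
    has to be checked for [fourier], and fourier^4 = c^2 act(w) with c = (rho (x) rho)(Q),
    combined with the homotopy between left and right multiplication by the central
    element w (eps w = 1), gives (2).

    In degree 0 everything follows from Q = (w (x) w) Delta(v): the right integral property
    gives v fourier(v a) = rho(v a_(1)) a_(2) =: X(a).  Comparing this with its mirror image
    at v and using factorizability gives rho(xy) = rho(S^2(y) x), without any discussion of
    unimodularity.  Hence rho(Q_1) Q_2 is a central integral, and the map X' obtained from w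
    in place of v satisfies X' X = c.  Finally fourier^2 = c Y with Y(b) = R_2 S(b) u R_1,
    and Y^2 = act(w). *)

(* Sweedler-style evaluation and predicates for multilinear maps *)
Reserved Notation "\E( x , y <- t ) e"
  (at level 41, x name, y name, e at level 41, format "\E( x , y  <-  t )  e").
Notation "\E( x , y <- t ) e" := (Ev2 (fun x y => e) t) : ring_scope.

Definition lin (K : fieldType) (V W : lmodType K) (f : V -> W) : Prop :=
  forall k u v, f (k *: u + v) = k *: f u + f v.
Definition bil (K : fieldType) (U V W : lmodType K) (F : U -> V -> W) : Prop :=
  (forall y, lin (fun x => F x y)) /\ (forall x, lin (F x)).
Definition tri (K : fieldType) (U V W X : lmodType K) (F : U -> V -> W -> X) : Prop :=
  [/\ forall y z, lin (fun x => F x y z), forall x z, lin (fun y => F x y z)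
    & forall x y, lin (F x y)].

Section Linear.
Variable K : fieldType.
Implicit Types (U V W X Y : lmodType K) (B : algType K).

Lemma lin0 V W (f : V -> W) : lin f -> f 0 = 0.
Proof. by move=> h; have := h (-1) 0 0; rewrite scaler0 addr0 scaleN1r addNr. Qed.

Lemma linD V W (f : V -> W) : lin f -> {morph f : x y / x + y}.
Proof. by move=> h x y; have := h 1 x y; rewrite !scale1r. Qed.

Lemma linZ V W (f : V -> W) k : lin f -> {morph f : x / k *: x}.
Proof. by move=> h x; have := h k x 0; rewrite (lin0 h) !addr0. Qed.

Lemma lin_sum V W (f : V -> W) I r (P : pred I) E : lin f ->
  f (\sum_(i <- r | P i) E i) = \sum_(i <- r | P i) f (E i).
Proof. by move=> h; apply: big_morph; [exact: linD | exact: lin0]. Qed.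

Lemma lin_id V : lin (fun x : V => x). Proof. by []. Qed.

Lemma lin_comp U V W (g : V -> W) (f : U -> V) :
  lin g -> lin f -> lin (fun x => g (f x)).
Proof. by move=> hg hf k u v; rewrite hf hg. Qed.

Lemma lin_mull V B (f : V -> B) c : lin f -> lin (fun x => c * f x).
Proof. by move=> hf k u v; rewrite hf mulrDr scalerAr. Qed.

Lemma lin_mulr V B (f : V -> B) c : lin f -> lin (fun x => f x * c).
Proof. by move=> hf k u v; rewrite hf mulrDl scalerAl. Qed.

Lemma lin_scalel V W (f : V -> K^o) (c : W) : lin f -> lin (fun x => (f x : K) *: c).
Proof. by move=> hf k u v; rewrite hf scalerDl scalerA. Qed.

Lemma lin_scaler V W (f : V -> W) (c : K) : lin f -> lin (fun x => c *: f x).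
Proof. by move=> hf k u v; rewrite hf scalerDr !scalerA mulrC. Qed.

Lemma bil_lin1 U V W X (F : U -> V -> W) (f : X -> U) y :
  bil F -> lin f -> lin (fun x => F (f x) y).
Proof. by case=> h _ hf k u v; rewrite hf h. Qed.

Lemma bil_lin2 U V W X (F : U -> V -> W) (f : X -> V) x :
  bil F -> lin f -> lin (fun y => F x (f y)).
Proof. by case=> _ h hf k u v; rewrite hf h. Qed.

Lemma tri_lin1 U V W X Y (F : U -> V -> W -> Y) (f : X -> U) y z :
  tri F -> lin f -> lin (fun x => F (f x) y z).
Proof. by case=> h _ _ hf k u v; rewrite hf h. Qed.

Lemma tri_lin2 U V W X Y (F : U -> V -> W -> Y) (f : X -> V) x z :
  tri F -> lin f -> lin (fun y => F x (f y) z).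
Proof. by case=> _ h _ hf k u v; rewrite hf h. Qed.

Lemma tri_lin3 U V W X Y (F : U -> V -> W -> Y) (f : X -> W) x y :
  tri F -> lin f -> lin (fun z => F x y (f z)).
Proof. by case=> _ _ h hf k u v; rewrite hf h. Qed.

End Linear.

(** * Evaluating multilinear maps on tensors given by coordinates *)

Section Tensor.
Variables (K : fieldType) (A : falgType K).
Implicit Types (V W : lmodType K) (t : T2 A).

Lemma crd_lin i : lin (@crd K A i : A -> K^o).
Proof. by move=> k u v; rewrite /crd linearP. Qed.

Lemma crdE (x : A) : x = \sum_i crd i x *: bv i.
Proof. by have := coord_vbasis (memvf x); rewrite /bv /bas /dimA => {1}->; apply: eq_bigr => i _; rewrite (tnth_nth 0). Qed.

Lemma eq_Ev2 V (F G : A -> A -> V) t : (forall x y, F x y = G x y) -> Ev2 F t = Ev2 G t.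
Proof. by move=> e; apply: eq_bigr => p _; rewrite e. Qed.

Lemma Ev2_lint V (F : A -> A -> V) : lin (Ev2 F).
Proof.
move=> k s t; rewrite /Ev2 scaler_sumr -big_split /=; apply: eq_bigr => p _.
by rewrite !ffunE scalerDl scalerA.
Qed.

Lemma lin_Ev2t V W (F : A -> A -> V) (f : W -> T2 A) : lin f -> lin (fun x => Ev2 F (f x)).
Proof. by move=> hf k u v; rewrite hf Ev2_lint. Qed.

Lemma lin_Ev2 V W (F : W -> A -> A -> V) t :
  (forall y z, lin (fun x => F x y z)) -> lin (fun x => Ev2 (F x) t).
Proof.
move=> h k u v; rewrite /Ev2 scaler_sumr -big_split /=; apply: eq_bigr => p _.
by rewrite h scalerDr !scalerA mulrC.
Qed.

Lemma linEv2 V W (f : V -> W) (F : A -> A -> V) t :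
  lin f -> f (Ev2 F t) = Ev2 (fun x y => f (F x y)) t.
Proof. by move=> h; rewrite lin_sum //; apply: eq_bigr => p _; rewrite linZ. Qed.

Lemma Ev2_mulr (F : A -> A -> A) t c : Ev2 F t * c = \E(x, y <- t) (F x y * c).
Proof. exact/(linEv2 (f := fun z => z * c))/lin_mulr/lin_id. Qed.

Lemma Ev2_mull (F : A -> A -> A) t c : c * Ev2 F t = \E(x, y <- t) (c * F x y).
Proof. exact/(linEv2 (f := fun z => c * z))/lin_mull/lin_id. Qed.

Lemma Ev2_scaler V (F : A -> A -> V) t (c : K) : c *: Ev2 F t = \E(x, y <- t) (c *: F x y).
Proof. exact/(linEv2 (f := fun z => c *: z))/lin_scaler/lin_id. Qed.

Lemma Ev2_exch V (F : A -> A -> A -> A -> V) s t :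
  \E(x, y <- s) \E(x', y' <- t) F x y x' y' = \E(x', y' <- t) \E(x, y <- s) F x y x' y'.
Proof.
rewrite /Ev2; under eq_bigr => p _ do rewrite scaler_sumr.
rewrite exchange_big /=; apply: eq_bigr => q _; rewrite scaler_sumr.
by apply: eq_bigr => p _; rewrite !scalerA mulrC.
Qed.

Lemma Ev2_pt V (F : A -> A -> V) x y : bil F -> Ev2 F (pt2 x y) = F x y.
Proof.
case=> h1 h2; rewrite {2}(crdE x) (lin_sum _ _ _ (h1 _)).
under [RHS]eq_bigr => i _ do rewrite (linZ _ (h1 _)) {1}(crdE y) (lin_sum _ _ _ (h2 _)) scaler_sumr.
rewrite pair_bigA; apply: eq_bigr => -[i j] _ /=.
by rewrite ffunE /= (linZ _ (h2 _)) scalerA.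
Qed.

Lemma Ev3_lint V (F : A -> A -> A -> V) : lin (Ev3 F).
Proof.
move=> k s t; rewrite /Ev3 scaler_sumr -big_split /=; apply: eq_bigr => p _.
by rewrite !ffunE scalerDl scalerA.
Qed.

Lemma eq_Ev3 V (F G : A -> A -> A -> V) (t : T3 A) :
  (forall x y z, F x y z = G x y z) -> Ev3 F t = Ev3 G t.
Proof. by move=> e; apply: eq_bigr => p _; rewrite e. Qed.

Lemma Ev3_pt V (F : A -> A -> A -> V) x y z : tri F -> Ev3 F (pt3 x y z) = F x y z.
Proof.
case=> h1 h2 h3; rewrite {2}(crdE x) (lin_sum _ _ _ (h1 _ _)).
under [RHS]eq_bigr => i _ do rewrite (linZ _ (h1 _ _)) {1}(crdE y) (lin_sum _ _ _ (h2 _ _)) scaler_sumr.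
rewrite pair_bigA.
under [RHS]eq_bigr => i _ do rewrite (linZ _ (h2 _ _)) {1}(crdE z) (lin_sum _ _ _ (h3 _ _)) !scaler_sumr.
rewrite pair_bigA; apply: eq_bigr => -[[i j] k] _ /=.
by rewrite ffunE /= (linZ _ (h3 _ _)) !scalerA.
Qed.

Lemma Ev2B V (F G : A -> A -> V) t : \E(x, y <- t) (F x y - G x y) = Ev2 F t - Ev2 G t.
Proof. by rewrite /Ev2 -sumrB; apply: eq_bigr => p _; rewrite scalerBr. Qed.

Lemma lin_Ev3 V W (F : W -> A -> A -> A -> V) (t : T3 A) :
  (forall x y z, lin (fun c => F c x y z)) -> lin (fun c => Ev3 (F c) t).
Proof.
move=> h k u u'; rewrite /Ev3 scaler_sumr -big_split /=; apply: eq_bigr => p _.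
by rewrite h scalerDr !scalerA mulrC.
Qed.

Lemma linEv3 V W (f : V -> W) (F : A -> A -> A -> V) (t : T3 A) :
  lin f -> f (Ev3 F t) = Ev3 (fun x y z => f (F x y z)) t.
Proof. by move=> h; rewrite lin_sum //; apply: eq_bigr => p _; rewrite linZ. Qed.

Lemma Ev3_Ev2 V (F : A -> A -> A -> A -> A -> V) (t : T3 A) (s : T2 A) :
  Ev3 (fun x y z => \E(p, q <- s) F p q x y z) t = \E(p, q <- s) Ev3 (F p q) t.
Proof.
rewrite /Ev2 /Ev3; under eq_bigr => i _ do rewrite scaler_sumr.
rewrite exchange_big /=; apply: eq_bigr => q _; rewrite scaler_sumr.
by apply: eq_bigr => i _; rewrite !scalerA mulrC.
Qed.

End Tensor.

Create HintDb linear.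
(** Only one factor of a multilinear expression contains the bound variable. A case that descends
    into the wrong factor fails to unify, and the match goes on to the next one. *)
Ltac lin_step :=
  cbv beta; match goal with
  | |- bil _ => split
  | |- tri _ => split
  | |- forall _, _ => intro
  | H : lin ?g |- lin ?g => exact H
  | |- lin (fun x => x) => exact: lin_id
  | H : lin ?g |- lin (fun x => ?g (@?f x)) => apply: (@lin_comp _ _ _ _ g f H)
  | H : bil ?F |- lin (?F ?y) => exact (proj2 H y)
  | H : bil ?F |- lin (fun x => ?F (@?f x) ?y) => apply: (@bil_lin1 _ _ _ _ _ F f y H)
  | H : bil ?F |- lin (fun x => ?F ?y (@?f x)) => apply: (@bil_lin2 _ _ _ _ _ F f y H)
  | H : tri ?F |- lin (fun x => ?F (@?f x) ?y ?z) => apply: (@tri_lin1 _ _ _ _ _ _ F f y z H)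
  | H : tri ?F |- lin (fun x => ?F ?y (@?f x) ?z) => apply: (@tri_lin2 _ _ _ _ _ _ F f y z H)
  | H : tri ?F |- lin (fun x => ?F ?y ?z (@?f x)) => apply: (@tri_lin3 _ _ _ _ _ _ F f y z H)
  | |- lin (fun x => Ev2 _ (@?f x)) => apply: (@lin_Ev2t _ _ _ _ _ f)
  | |- lin (fun x => Ev2 _ _) => apply: lin_Ev2
  | |- lin (fun x => _ *: (@?f x)) => apply: (@lin_scaler _ _ _ f)
  | |- lin (fun x => (@?f x) *: _) => apply: (@lin_scalel _ _ _ f)
  | |- lin (fun x => _ * (@?f x)) => apply: (@lin_mull _ _ _ f)
  | |- lin (fun x => (@?f x) * _) => apply: (@lin_mulr _ _ _ f)
  | |- lin _ => solve [auto 2 with linear]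
  | |- @lin ?K ?V ?W (fun x => ?g (@?f x)) => apply: (@lin_comp K V _ W g f); [solve [auto 2 with linear] | ]
  end.
Ltac lintac := repeat lin_step.

Section TensorMul.
Variables (K : fieldType) (A : falgType K).
Implicit Types (V W : lmodType K) (t : T2 A).

Lemma Ev2_tmul V (F : A -> A -> V) s t : bil F ->
  Ev2 F (tmul2 s t) = \E(x, y <- s) \E(x', y' <- t) F (x * x') (y * y').
Proof.
move=> hF; rewrite /tmul2 (linEv2 _ _ (Ev2_lint F)); apply: eq_Ev2 => x y.
rewrite (linEv2 _ _ (Ev2_lint F)); apply: eq_Ev2 => x' y'.
by rewrite Ev2_pt.
Qed.

Lemma Ev2_flip V (F : A -> A -> V) t : bil F ->
  Ev2 F (flip2 t) = \E(x, y <- t) F y x.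
Proof.
move=> hF; rewrite /flip2 (linEv2 _ _ (Ev2_lint F)); apply: eq_Ev2 => x y.
by rewrite Ev2_pt.
Qed.

Lemma Ev3_tmul V (F : A -> A -> A -> V) (s t : T3 A) : tri F ->
  Ev3 F (tmul3 s t) =
  Ev3 (fun x y z => Ev3 (fun x' y' z' => F (x * x') (y * y') (z * z')) t) s.
Proof.
move=> hF; rewrite /tmul3 [LHS](lin_sum _ _ _ (Ev3_lint F)); apply: eq_bigr => p _.
rewrite (linZ _ (Ev3_lint F)) (lin_sum _ _ _ (Ev3_lint F)); congr (_ *: _).
by apply: eq_bigr => q _; rewrite (linZ _ (Ev3_lint F)) Ev3_pt.
Qed.

Lemma Ev3_DeltaL V (D : A -> T2 A) (F : A -> A -> A -> V) t : tri F ->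
  Ev3 F (DeltaL D t) = \E(x, y <- t) \E(x1, x2 <- D x) F x1 x2 y.
Proof.
move=> hF; rewrite /DeltaL (linEv2 _ _ (Ev3_lint F)); apply: eq_Ev2 => x y.
by rewrite (linEv2 _ _ (Ev3_lint F)); apply: eq_Ev2 => x' y'; rewrite Ev3_pt.
Qed.

Lemma Ev3_DeltaR V (D : A -> T2 A) (F : A -> A -> A -> V) t : tri F ->
  Ev3 F (DeltaR D t) = \E(x, y <- t) \E(y1, y2 <- D y) F x y1 y2.
Proof.
move=> hF; rewrite /DeltaR (linEv2 _ _ (Ev3_lint F)); apply: eq_Ev2 => x y.
by rewrite (linEv2 _ _ (Ev3_lint F)); apply: eq_Ev2 => x' y'; rewrite Ev3_pt.
Qed.

End TensorMul.

Ltac mulr_assoc := do ?[apply: eq_Ev2 => ? ?]; by rewrite ?mulrA.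

(** * Cochains as multilinear functions on sequences *)

Section Cochains.
Variables (K : fieldType) (A : falgType K).
Implicit Types (V W : lmodType K).

(* Linearity in each of the first n entries, on sequences of size n only. *)
Fixpoint mlin V n (G : seq A -> V) : Prop :=
  if n is n'.+1 then
    (forall s, size s = n' -> lin (fun a => G (a :: s))) /\
    (forall a, mlin n' (fun s => G (a :: s)))
  else True.

(** Stands in for functional extensionality: only values on sequences of size n matter. *)
Lemma eq_mlin V n (G H : seq A -> V) :
  (forall s, size s = n -> G s = H s) -> mlin n G -> mlin n H.
Proof.
elim: n G H => //= n IH G H e [hl hm]; split=> [s sz k x y | a].
  by rewrite -!e ?hl //= sz.
by apply: IH (hm a) => s sz; apply: e; rewrite /= sz.
Qed.

Lemma mlin_Ev2 V n (G : A -> A -> seq A -> V) t :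
  (forall x y, mlin n (G x y)) -> mlin n (fun s => \E(x, y <- t) G x y s).
Proof.
elim: n G => //= n IH G h; split=> [s sz | a].
  move=> k u u'; rewrite /Ev2 scaler_sumr -big_split /=; apply: eq_bigr => p _.
  by rewrite (proj1 (h _ _)) // scalerDr !scalerA mulrC.
by apply: IH => x y; apply: (proj2 (h x y)).
Qed.

Lemma mlin_comp V W n (G : seq A -> V) (f : V -> W) :
  lin f -> mlin n G -> mlin n (fun s => f (G s)).
Proof.
move=> hf; elim: n G => //= n IH G [hl hm]; split=> [s sz | a]; last exact: IH.
by move=> k x y; rewrite hl // hf.
Qed.

Lemma mlin_sub V n (G H : seq A -> V) :
  mlin n G -> mlin n H -> mlin n (fun s => G s - H s).
Proof.
elim: n G H => //= n IH G H [gl gm] [hl hm]; split=> [s sz | a]; last exact: IH.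
by move=> k x y; rewrite gl // hl // scalerBr opprD addrACA.
Qed.

Definition tabulate n (G : seq A -> A) : Coch A n := [ffun idx => G (Defs.bseq idx)].

Definition slice n (f : Coch A n.+1) (i : 'I_(dimA A)) : Coch A n :=
  [ffun t => f (cons_tuple i t)].

(** Peeling off the first argument is what makes induction on n possible below. *)
Lemma cev_cons n (f : Coch A n.+1) a s :
  cev f (a :: s) = \sum_i crd i a *: cev (slice f i) s.
Proof.
rewrite /cev.
have bij : {on predT, bijective (fun p : 'I_(dimA A) * n.-tuple 'I_(dimA A) => cons_tuple p.1 p.2)}.
  apply: onW_bij; exists (fun t => (thead t, behead_tuple t)) => [[i t] | t] /=.
    by rewrite theadE; congr (_, _); apply: val_inj.
  by rewrite [RHS]tuple_eta; apply: val_inj.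
rewrite (reindex _ bij) /= -(pair_bigA _ (fun i t => (\prod_(m < n.+1)
  crd (tnth (cons_tuple i t) m) (nth 0 (a :: s) m)) *: f (cons_tuple i t))) /=.
apply: eq_bigr => i _; rewrite scaler_sumr; apply: eq_bigr => t _.
rewrite ffunE scalerA big_ord_recl /=; congr (_ * _ *: _).
by apply: eq_bigr => m _; rewrite tnthS.
Qed.

Lemma cev_nil (f : Coch A 0) : cev f [::] = f [tuple].
Proof.
rewrite /cev (bigD1 [tuple]) //= big_ord0 scale1r big1 ?addr0 // => t /eqP [].
by apply: val_inj => /=; rewrite (tuple0 t).
Qed.

Lemma cev_bseq n (f : Coch A n) idx : cev f (Defs.bseq idx) = f idx.
Proof.
have crd_bv i j : crd i (bv j) = (i == j)%:R :> K.
  by rewrite /crd /bv (tnth_nth 0) coord_free ?(basis_free (vbasisP _)) // eq_sym.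
rewrite /cev (bigD1 idx) //= [X in _ + X]big1 ?addr0 => [|t /eqP tN].
  rewrite big1 ?scale1r // => m _.
  by rewrite (nth_map (tnth idx m)) ?size_tuple // -tnth_nth crd_bv eqxx.
have [m hm] : exists m, tnth t m != tnth idx m.
  apply/existsP; rewrite -[X in is_true X]negbK negb_exists; apply/negP => /forallP h.
  by case: tN; apply: eq_from_tnth => m; apply/eqP; have := h m; rewrite negbK.
rewrite (bigD1 m) //= (nth_map (tnth idx m)) ?size_tuple // -tnth_nth crd_bv (negPf hm).
by rewrite mul0r scale0r.
Qed.

Lemma cev_lin n s : lin (fun f : Coch A n => cev f s).
Proof.
move=> k f g; rewrite /cev scaler_sumr -big_split; apply: eq_bigr => i _ /=.
by rewrite !ffunE scalerDr !scalerA (mulrC k).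
Qed.

Lemma mlin_cev n (f : Coch A n) : mlin n (cev f).
Proof.
elim: n f => //= n IH f; split=> [s sz k x y | a].
  rewrite !cev_cons scaler_sumr -big_split; apply: eq_bigr => i _ /=.
  by rewrite crd_lin scalerDl scalerA.
apply: (@eq_mlin _ _ (cev (\sum_i crd i a *: slice f i))) => // s _.
rewrite cev_cons (lin_sum _ _ _ (@cev_lin n s)).
by apply: eq_bigr => i _; rewrite (linZ _ (@cev_lin n s)).
Qed.

(** Expanding each argument in the basis determines a multilinear function from its values on basis
    tensors, so cochains and multilinear functions on sequences are interchangeable. *)
Lemma cev_tabulate n (G : seq A -> A) s : mlin n G -> size s = n -> cev (tabulate n G) s = G s.
Proof.
elim: n G s => [|n IH] G [|a s] //=; first by rewrite cev_nil ffunE.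
move=> [hl hm] [sz]; rewrite cev_cons [in RHS](crdE a) (lin_sum _ _ _ (hl s sz)).
apply: eq_bigr => i _; rewrite (linZ _ (hl s sz)) -(IH (fun s => G (bv i :: s))) //.
by congr (_ *: cev _ _); apply/ffunP => t; rewrite !ffunE.
Qed.

Lemma cev_inj n (f g : Coch A n) :
  (forall s, size s = n -> cev f s = cev g s) -> f = g.
Proof.
by move=> e; apply/ffunP => idx; rewrite -!cev_bseq e // size_map size_tuple.
Qed.

End Cochains.

(** * Hochschild complexes as functions on sequences *)

Section ListHochschild.
Variables (K : fieldType) (A : falgType K) (M : lmodType K).
Variables (lt rt : A -> M -> M).
Hypothesis ltB : forall a x y, lt a (x - y) = lt a x - lt a y.
Hypothesis rtB : forall a x y, rt a (x - y) = rt a x - rt a y.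
Implicit Types f g : seq A -> M.

(* The Hochschild differential is [face0 - faces]: [faces] collects the inner faces
   and the last one, with f |-> f(a, -) as its recursion step. *)
Definition face0 f (s : seq A) : M := if s is a :: s' then lt a (f s') else 0.

Fixpoint faces f (s : seq A) : M :=
  if s is a :: s' then
    if s' is b :: s'' then f (a * b :: s'') - faces (fun l => f (a :: l)) s'
    else rt a (f [::])
  else 0.

Definition seqdiff f s := face0 f s - faces f s.

(** The alternating sum over all positions at which z can be inserted: the classical homotopy
    between the left and the right action of a central element. *)
Fixpoint insertion (z : A) f (s : seq A) : M :=
  if s is a :: s' then f (z :: s) - insertion z (fun l => f (a :: l)) s' else f [:: z].

Lemma faces_cons f a b s :
  faces f [:: a, b & s] = f (a * b :: s) - faces (fun l => f (a :: l)) (b :: s).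
Proof. by []. Qed.

Lemma eq_faces f g s : (forall l, size l = (size s).-1 -> f l = g l) -> faces f s = faces g s.
Proof.
elim: s f g => //= a [|b s] IH f g e; first by rewrite e.
by rewrite (e (_ :: _)) // (IH _ (fun l => g (a :: l))) // => l sz; rewrite e //= sz.
Qed.

Lemma facesB f g s : faces (fun l => f l - g l) s = faces f s - faces g s.
Proof.
elim: s f g => [|a [|b s] IH] f g; rewrite ?subr0 //=.
by move: (IH (fun l => f (a :: l)) (fun l => g (a :: l))) => /= ->; rewrite !opprB addrACA [RHS]addrACA; congr (_ + _); rewrite addrC.
Qed.

Lemma eq_insertion z f g s : (forall l, size l = (size s).+1 -> f l = g l) -> insertion z f s = insertion z g s.
Proof.
elim: s f g => [|a s IH] f g e /=; first by rewrite e.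
by rewrite (e (_ :: _)) // (IH _ (fun l => g (a :: l))) // => l sz; rewrite e //= sz.
Qed.

Lemma insertionB z f g s : insertion z (fun l => f l - g l) s = insertion z f s - insertion z g s.
Proof.
elim: s f g => [|a s IH] f g //=.
by rewrite IH !opprB addrACA [RHS]addrACA; congr (_ + _); rewrite addrC.
Qed.

Lemma insertion_lt z a f s : insertion z (fun l => lt a (f l)) s = lt a (insertion z f s).
Proof. by elim: s f => [|b s IH] f //=; rewrite IH ltB. Qed.

Lemma face0_insertion z f s : insertion z (face0 f) s + face0 (insertion z f) s = lt z (f s).
Proof. by case: s => [|a s] /=; rewrite ?addr0 // insertion_lt subrK. Qed.

(** With z inserted just before or just after an argument a, merging produces z a and a z with
    opposite signs, which cancel since z is central. Only z in last place, meeting the last face,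
    survives. *)
Lemma faces_insertion z f s : (forall a, z * a = a * z) ->
  insertion z (faces f) s + faces (insertion z f) s = rt z (f s).
Proof.
move=> zC; elim: s f => [|a [|b s] IH] f; first by rewrite /= addr0.
  rewrite /= zC !(opprD, opprK, addrA) [LHS](ACl ((1*3)*(2*5)*4)) /=.
  by rewrite !(subrr, addNr, add0r).
have fz : faces f [:: z, a, b & s] = f (z * a :: b :: s) - (f (z :: a * b :: s) - faces (fun l => f [:: z, a & l]) (b :: s)) by [].
have hBa : insertion z (fun l => faces f (a :: l)) (b :: s) =
    insertion z (fun l => if l is c :: l' then f (a * c :: l') else 0) (b :: s)
      - insertion z (faces (fun l => f (a :: l))) (b :: s).
  by rewrite -insertionB; apply: eq_insertion => -[|c l].
have hb : insertion z (fun l => if l is c :: l' then f (a * c :: l') else 0) (b :: s) =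
   f (a * z :: b :: s) - insertion z (fun l => f (a * b :: l)) s by [].
have Bh : faces (insertion z f) [:: a, b & s] = (f (z :: a * b :: s) - insertion z (fun l => f (a * b :: l)) s)
   - (faces (fun l => f [:: z, a & l]) (b :: s) - faces (insertion z (fun l => f (a :: l))) (b :: s)).
  by rewrite -facesB.
have hB : insertion z (faces f) [:: a, b & s] = faces f [:: z, a, b & s] - insertion z (fun l => faces f (a :: l)) (b :: s) by [].
rewrite hB Bh hBa fz hb -zC -(IH (fun l => f (a :: l))).
(* Here x5 and x6 are the two terms of the induction hypothesis for f(a, -); everything else cancels
   in pairs. *)
have aux (x1 x2 x3 x4 x5 x6 : M) :
    x1 - (x2 - x3) - (x1 - x4 - x5) + (x2 - x4 - (x3 - x6)) = x5 + x6.
  rewrite !(opprD, opprK, addrA) [LHS](ACl ((1*4)*(2*7)*(3*9)*(5*8)*6*10)) /=.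
  by rewrite !(subrr, addNr, add0r).
exact: aux.
Qed.

Lemma seqdiff_insertion z f s : (forall a, z * a = a * z) ->
  seqdiff (insertion z f) s + insertion z (seqdiff f) s = lt z (f s) - rt z (f s).
Proof.
move=> zC; rewrite /seqdiff insertionB -(faces_insertion _ _ zC) -face0_insertion addrACA opprD [- _ - _]addrC.
by rewrite (addrC (face0 _ _)).
Qed.

End ListHochschild.
(** * Hopf algebra identities in Sweedler form *)

Section Hopf.
Variables (K : fieldType) (A : falgType K).
Variables (D : A -> T2 A) (eps : A -> K) (S Sinv : A -> A).
Hypothesis HH : is_Hopf_algebra D eps S.
Hypothesis HI : is_inverse_antipode S Sinv.
Implicit Types (V W : lmodType K) (a b x y : A).

Lemma lin_Delta : lin D. Proof. by case: HH => -[]. Qed.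
Lemma lin_eps : lin (eps : A -> K^o). Proof. by case: HH => -[]. Qed.
Lemma lin_S : lin S. Proof. by case: HH => -[]. Qed.
Lemma SK : cancel S Sinv. Proof. by case: HI. Qed.
Lemma SinvK : cancel Sinv S. Proof. by case: HI. Qed.
Lemma lin_Sinv : lin Sinv.
Proof. by move=> k u v; apply: (can_inj SK); rewrite SinvK lin_S !SinvK. Qed.
Hint Resolve lin_Delta lin_eps lin_S lin_Sinv : linear.

Lemma coassoc V (F : A -> A -> A -> V) a : tri F ->
  \E(x, y <- D a) \E(x1, x2 <- D x) F x1 x2 y = \E(x, y <- D a) \E(y1, y2 <- D y) F x y1 y2.
Proof. by move=> hF; rewrite -Ev3_DeltaL // -Ev3_DeltaR //; case: HH => _ ->. Qed.

Lemma Delta_mul V (F : A -> A -> V) a b : bil F ->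
  Ev2 F (D (a * b)) = \E(x, y <- D a) \E(x', y' <- D b) F (x * x') (y * y').
Proof. by move=> hF; case: HH => _ _ [-> _] _ _; apply: Ev2_tmul. Qed.

Lemma Delta_one V (F : A -> A -> V) : bil F -> Ev2 F (D 1) = F 1 1.
Proof. by move=> hF; case: HH => _ _ [_ ->] _ _; apply: Ev2_pt. Qed.

Lemma epsM a b : eps (a * b) = eps a * eps b.
Proof. by case: HH => _ _ _ []. Qed.

Lemma eps1 : eps 1 = 1.
Proof. by case: HH => _ _ _ []. Qed.

Lemma counitl V (f : A -> V) a : lin f -> \E(x, y <- D a) (eps x *: f y) = f a.
Proof.
move=> hf; case: HH => _ _ _ _ [/(_ a) [e _] _]; rewrite -[in RHS]e (linEv2 _ _ hf).
by apply: eq_Ev2 => x y; rewrite (linZ _ hf).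
Qed.

Lemma counitr V (f : A -> V) a : lin f -> \E(x, y <- D a) (eps y *: f x) = f a.
Proof.
move=> hf; case: HH => _ _ _ _ [/(_ a) [_ e] _]; rewrite -[in RHS]e (linEv2 _ _ hf).
by apply: eq_Ev2 => x y; rewrite (linZ _ hf).
Qed.

Lemma antipodel V (f : A -> V) a : lin f -> \E(x, y <- D a) f (S x * y) = eps a *: f 1.
Proof.
by move=> hf; case: HH => _ _ _ _ [_ /(_ a) [e _]]; rewrite -(linZ _ hf) -e (linEv2 _ _ hf).
Qed.

Lemma antipoder V (f : A -> V) a : lin f -> \E(x, y <- D a) f (x * S y) = eps a *: f 1.
Proof.
by move=> hf; case: HH => _ _ _ _ [_ /(_ a) [_ e]]; rewrite -(linZ _ hf) -e (linEv2 _ _ hf).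
Qed.

Lemma S1 : S 1 = 1.
Proof.
have := antipodel 1 (@lin_id _ A); rewrite Delta_one; last by lintac.
by rewrite mulr1 eps1 scale1r.
Qed.

Lemma epsS a : eps (S a) = eps a.
Proof.
have := antipodel a lin_eps; rewrite eps1 => /esym; rewrite /GRing.scale /= mulr1 => ->.
rewrite -(@counitr (K^o) (fun x => eps (S x))); last by lintac.
by apply: (@eq_Ev2 _ _ (K^o)) => x y; rewrite epsM mulrC.
Qed.

Lemma antipoder_ins V (G : A -> A -> V) a : bil G ->
  \E(x, y <- D a) \E(y1, y2 <- D y) G x (y1 * S y2) = G a 1.
Proof.
move=> hG; rewrite -(@counitr _ (fun z => G z 1)); last by lintac.
by apply: eq_Ev2 => x y; rewrite (@antipoder _ (G x)); last by lintac.
Qed.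

Lemma antipodel_ins V (G : A -> A -> V) a : bil G ->
  \E(x, y <- D a) \E(x1, x2 <- D x) G (S x1 * x2) y = G 1 a.
Proof.
move=> hG; rewrite -(@counitl _ (G 1)); last by lintac.
by apply: eq_Ev2 => x y; rewrite (@antipodel _ (G^~ y)); last by lintac.
Qed.

(** First S(c_(1) d) c_(2) = eps(c) S(d): insert d_(2) S(d_(3)) and apply the antipode axiom to the
    product of c and d_(1). Then insert a_(2) S(a_(3)) after S(a_(1) b). *)
Lemma SM a b : S (a * b) = S b * S a.
Proof.
have S1b c d : \E(x, y <- D c) (S (x * d) * y) = eps c *: S d.
  transitivity (\E(x, y <- D c) \E(x', y' <- D d) \E(x1, x2 <- D x') (S (x * x1) * (y * (x2 * S y')))).
    apply: eq_Ev2 => x y; rewrite coassoc; last by lintac.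
    by rewrite (@antipoder_ins _ (fun z w => S (x * z) * (y * w))) ?mulr1 //; lintac.
  rewrite Ev2_exch -(@counitl _ (fun z => eps c *: S z)); last by lintac.
  apply: eq_Ev2 => x' y'.
  transitivity (\E(x, y <- D (c * x')) (S x * y * S y')).
    by rewrite Delta_mul; [mulr_assoc | lintac].
  rewrite (@antipodel _ (fun z => z * S y')); last by lintac.
  by rewrite epsM mul1r scalerA mulrC.
transitivity (\E(x, y <- D a) \E(x1, x2 <- D x) (S (x1 * b) * x2 * S y)).
  rewrite coassoc; last by lintac.
  rewrite -[S _]mulr1 -(@antipoder_ins _ (fun z w => S (z * b) * w)); last by lintac.
  mulr_assoc.
rewrite -(@counitl _ (fun z => S b * S z)); last by lintac.
by apply: eq_Ev2 => x y; rewrite -Ev2_mulr S1b scalerAl.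
Qed.

(** Multiply Delta(S x) by (y_(1) (x) y_(2)) (S y_(4) (x) S y_(3)) = eps(y) 1 (x) 1, which is [T1].
    After regrouping, Delta(S(x) y_(1)) collapses by the antipode axiom and the flipped S (x) S is
    left. *)
Lemma Delta_S V (F : A -> A -> V) a : bil F ->
  Ev2 F (D (S a)) = \E(x, y <- D a) F (S y) (S x).
Proof.
move=> hF.
have T1 (G : A -> A -> V) y : bil G ->
    \E(y1, y2 <- D y) \E(p, q <- D y1) \E(r, s <- D y2) G (p * S s) (q * S r) = eps y *: G 1 1.
  move=> hG; rewrite coassoc; last by lintac.
  rewrite -(@antipoder _ (G^~ 1)); last by lintac.
  apply: eq_Ev2 => p z; rewrite -coassoc; last by lintac.
  rewrite -(@counitl _ (fun z => G (p * S z) 1)); last by lintac.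
  by apply: eq_Ev2 => u s; rewrite (@antipoder _ (G (p * S s))); last by lintac.
pose G x p q := \E(w1, w2 <- D (S x)) F (w1 * p) (w2 * q).
transitivity (\E(x, y <- D a) \E(y1, y2 <- D y) \E(p, q <- D y1) \E(r, s <- D y2) G x (p * S s) (q * S r)).
  rewrite -(@counitr _ (fun x => Ev2 F (D (S x)))); last by lintac.
  apply: eq_Ev2 => x y; rewrite T1; last by rewrite /G; lintac.
  by congr (_ *: _); apply: eq_Ev2 => ? ?; rewrite !mulr1.
rewrite -coassoc; last by rewrite /G; lintac.
rewrite -(@counitl _ (fun z => \E(r, s <- D z) F (S s) (S r))); last by lintac.
apply: eq_Ev2 => x y2.
transitivity (\E(r, s <- D y2) \E(x1, y1 <- D x) \E(z1, z2 <- D (S x1 * y1)) F (z1 * S s) (z2 * S r)).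
  rewrite Ev2_exch; apply: eq_Ev2 => x1 y1; rewrite Ev2_exch; apply: eq_Ev2 => r s.
  rewrite Delta_mul; last by lintac.
  rewrite /G Ev2_exch; mulr_assoc.
rewrite Ev2_scaler; apply: eq_Ev2 => r s.
rewrite (@antipodel _ (fun z => \E(z1, z2 <- D z) F (z1 * S s) (z2 * S r))); last by lintac.
by rewrite Delta_one ?mul1r //; lintac.
Qed.

Lemma Sinv1 : Sinv 1 = 1.
Proof. by rewrite -[in LHS]S1 SK. Qed.

Lemma SinvM a b : Sinv (a * b) = Sinv b * Sinv a.
Proof. by apply: (can_inj SK); rewrite SM !SinvK. Qed.

Lemma Delta_Sinv V (F : A -> A -> V) a : bil F ->
  Ev2 F (D (Sinv a)) = \E(x, y <- D a) F (Sinv y) (Sinv x).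
Proof.
move=> hF; rewrite -[in RHS](SinvK a) Delta_S; last by lintac.
by apply: eq_Ev2 => x y; rewrite !SK.
Qed.

Lemma Sinvl V (f : A -> V) a : lin f -> \E(x, y <- D a) f (Sinv y * x) = eps a *: f 1.
Proof.
move=> hf; rewrite -Sinv1 -(@antipodel _ (fun z => f (Sinv z))); last by lintac.
by apply: eq_Ev2 => x y; rewrite SinvM SK.
Qed.

Lemma Sinvr V (f : A -> V) a : lin f -> \E(x, y <- D a) f (y * Sinv x) = eps a *: f 1.
Proof.
move=> hf; rewrite -Sinv1 -(@antipoder _ (fun z => f (Sinv z))); last by lintac.
by apply: eq_Ev2 => x y; rewrite SinvM SK.
Qed.

(** * The R-matrix, the ribbon element and the integral *)

Variables (R : T2 A) (v : A) (rho : A -> K).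
Hypothesis HQ : is_quasitriangular D R.
Hypothesis HR : is_ribbon_element D eps S R v.
Hypothesis HF : is_factorizable R.
Hypothesis Hrho : is_nonzero_right_integral D rho.

Lemma lin_rho : lin (rho : A -> K^o). Proof. by case: Hrho. Qed.
Hint Resolve lin_rho : linear.

Lemma R_DeltaL V (F : A -> A -> A -> V) : tri F ->
  \E(r1, r2 <- R) \E(x, y <- D r1) F x y r2 = \E(r1, r2 <- R) \E(s1, s2 <- R) F r1 s1 (r2 * s2).
Proof.
move=> hF; case: HQ => _ e _; rewrite -Ev3_DeltaL // e Ev3_tmul //.
have hG : tri (fun x y z => Ev3 (fun x' y' z' => F (x * x') (y * y') (z * z')) (R23 R)).
  split=> ? ? k a b; rewrite /Ev3 scaler_sumr -big_split /=; apply: eq_bigr => i _;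
  by case: hF => h1 h2 h3; rewrite mulrDl -scalerAl ?h1 ?h2 ?h3 scalerDr !scalerA (mulrC k).
rewrite /R13 (linEv2 _ _ (Ev3_lint _)); apply: eq_Ev2 => x y; rewrite Ev3_pt //.
rewrite /R23 (linEv2 _ _ (Ev3_lint _)); apply: eq_Ev2 => x' y'; rewrite Ev3_pt ?mulr1 ?mul1r //.
by lintac.
Qed.

Lemma R_DeltaR V (F : A -> A -> A -> V) : tri F ->
  \E(r1, r2 <- R) \E(x, y <- D r2) F r1 x y = \E(r1, r2 <- R) \E(s1, s2 <- R) F (r1 * s1) s2 r2.
Proof.
move=> hF; case: HQ => _ _ e; rewrite -Ev3_DeltaR // e Ev3_tmul //.
have hG : tri (fun x y z => Ev3 (fun x' y' z' => F (x * x') (y * y') (z * z')) (R12 R)).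
  split=> ? ? k a b; rewrite /Ev3 scaler_sumr -big_split /=; apply: eq_bigr => i _;
  by case: hF => h1 h2 h3; rewrite mulrDl -scalerAl ?h1 ?h2 ?h3 scalerDr !scalerA (mulrC k).
rewrite /R13 (linEv2 _ _ (Ev3_lint _)); apply: eq_Ev2 => x y; rewrite Ev3_pt //.
rewrite /R12 (linEv2 _ _ (Ev3_lint _)); apply: eq_Ev2 => x' y'; rewrite Ev3_pt ?mulr1 ?mul1r //.
by lintac.
Qed.

Lemma R_Delta V (F : A -> A -> V) a : bil F ->
  \E(r1, r2 <- R) \E(x, y <- D a) F (r1 * x) (r2 * y) = \E(x, y <- D a) \E(r1, r2 <- R) F (y * r1) (x * r2).
Proof.
move=> hF; case: HQ => -[Ri [_ Ri_l e]] _ _.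
pose F' p q := \E(r1, r2 <- R) F (p * r1) (q * r2).
have hF' : bil F' by rewrite /F'; lintac.
rewrite -[RHS](@Ev2_flip _ _ _ F') // e !Ev2_tmul //; last by lintac.
apply: eq_Ev2 => r1 r2; apply: eq_Ev2 => x y.
rewrite -[LHS](_ : Ev2 (fun p q => F (r1 * x * p) (r2 * y * q)) (one2 A) = _); last first.
  by rewrite Ev2_pt ?mulr1 //; lintac.
rewrite -Ri_l Ev2_tmul; last by lintac.
rewrite /F'; mulr_assoc.
Qed.

(** With e the left-hand side, applying the counit to the first leg of (Delta (x) id)(R) = R_13 R_23
    gives R = (1 (x) e) R, and R is invertible. *)
Lemma eps_R : \E(r1, r2 <- R) (eps r1 *: r2) = 1.
Proof.
set e := LHS; case: HQ => -[Ri [Ri_r _ _]] _ _.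
have Re (F : A -> A -> A) : bil F -> Ev2 F R = \E(s1, s2 <- R) F s1 (e * s2).
  move=> hF; transitivity (\E(r1, r2 <- R) \E(x, y <- D r1) (eps x *: F y r2)).
    by apply: eq_Ev2 => x y; rewrite (@counitl _ (fun z => F z y)) //; lintac.
  rewrite R_DeltaL; last by lintac.
  rewrite Ev2_exch; apply: eq_Ev2 => s1 s2.
  by rewrite [RHS](linEv2 (f := fun z => F s1 (z * s2))); [apply: eq_Ev2 => x y; rewrite -scalerAl (linZ _ (proj2 hF s1)) | lintac].
have one F : bil F -> \E(s1, s2 <- R) \E(t1, t2 <- Ri) F (s1 * t1) (s2 * t2) = F 1 1 :> A.
  by move=> hF; rewrite -Ev2_tmul // Ri_r Ev2_pt.
pose G c x y := eps x *: (c * y).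
have hG c : bil (G c) by rewrite /G; lintac.
have : G 1 1 1 = G e 1 1.
  rewrite -!one // (@Re (fun x y => \E(t1, t2 <- Ri) G 1 (x * t1) (y * t2))); last by rewrite /G; lintac.
  by apply: eq_Ev2 => ? ?; apply: eq_Ev2 => ? ?; rewrite /G mul1r mulrA.
by rewrite /G eps1 !mulr1 !scale1r.
Qed.

(** This is R^-1 = (S (x) id)(R), from the antipode axiom on the first leg of R and [eps_R]. *)
Lemma R_Sr V (F : A -> A -> V) : bil F ->
  \E(r1, r2 <- R) \E(s1, s2 <- R) F (r1 * S s1) (r2 * s2) = F 1 1.
Proof.
move=> hF; rewrite -(@R_DeltaL _ (fun x y z => F (x * S y) z)); last by lintac.
rewrite -[X in F 1 X]eps_R (linEv2 (f := F 1)); last by lintac.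
apply: eq_Ev2 => r1 r2; rewrite (@antipoder _ (F^~ r2)); last by lintac.
by rewrite (linZ _ (proj2 hF 1)).
Qed.

Lemma QmE V (F : A -> A -> V) : bil F ->
  Ev2 F (Qm R) = \E(r1, r2 <- R) \E(s1, s2 <- R) F (r2 * s1) (r1 * s2).
Proof. by move=> hF; rewrite /Qm Ev2_tmul // Ev2_flip //; lintac. Qed.

(** In leg notation (id (x) Delta)(Q) = R_21 Q_13 R_12: both factors of Q = R_21 R_12 are split by
    the hexagon identities. *)
Lemma Q_DeltaR V (H : A -> A -> A -> V) : tri H ->
  \E(q1, q2 <- Qm R) \E(x, y <- D q2) H q1 x y =
  \E(r1, r2 <- R) \E(s1, s2 <- R) \E(q1, q2 <- Qm R) H (r2 * q1 * s1) (r1 * s2) q2.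
Proof.
move=> hH; rewrite QmE; last by lintac.
transitivity (\E(r1, r2 <- R) \E(x, y <- D r1) \E(s1, s2 <- R) \E(x', y' <- D s2) H (r2 * s1) (x * x') (y * y')).
  apply: eq_Ev2 => r1 r2; rewrite [RHS]Ev2_exch; apply: eq_Ev2 => s1 s2; rewrite Delta_mul //.
  by lintac.
rewrite (@R_DeltaL _ (fun x y r2 => \E(s1, s2 <- R) \E(x', y' <- D s2) H (r2 * s1) (x * x') (y * y'))); last by lintac.
apply: eq_Ev2 => r1 r2.
transitivity (\E(t1, t2 <- R) \E(s1, s2 <- R) \E(p1, p2 <- R) H (r2 * t2 * (s1 * p1)) (r1 * p2) (t1 * s2)).
  by apply: eq_Ev2 => t1 t2; rewrite (@R_DeltaR _ (fun s1 x' y' => H (r2 * t2 * s1) (r1 * x') (t1 * y'))) //; lintac.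
transitivity (\E(p1, p2 <- R) \E(t1, t2 <- R) \E(s1, s2 <- R) H (r2 * t2 * (s1 * p1)) (r1 * p2) (t1 * s2)).
  rewrite [RHS]Ev2_exch; apply: eq_Ev2 => ? ?; exact: Ev2_exch.
apply: eq_Ev2 => p1 p2; rewrite QmE; last by lintac.
mulr_assoc.
Qed.

(** In leg notation (Delta (x) id)(Q) = R_32 Q_13 R_23. *)
Lemma Q_DeltaL V (H : A -> A -> A -> V) : tri H ->
  \E(q1, q2 <- Qm R) \E(x, y <- D q1) H x y q2 =
  \E(r1, r2 <- R) \E(s1, s2 <- R) \E(q1, q2 <- Qm R) H q1 (r2 * s1) (r1 * q2 * s2).
Proof.
move=> hH; rewrite QmE; last by lintac.
transitivity (\E(r1, r2 <- R) \E(x, y <- D r2) \E(s1, s2 <- R) \E(x', y' <- D s1) H (x * x') (y * y') (r1 * s2)).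
  apply: eq_Ev2 => r1 r2; rewrite [RHS]Ev2_exch; apply: eq_Ev2 => s1 s2; rewrite Delta_mul //.
  by lintac.
rewrite (@R_DeltaR _ (fun r1 x y => \E(s1, s2 <- R) \E(x', y' <- D s1) H (x * x') (y * y') (r1 * s2))); last by lintac.
apply: eq_Ev2 => r1 r2.
transitivity (\E(t1, t2 <- R) \E(s1, s2 <- R) \E(p1, p2 <- R) H (t2 * s1) (r2 * p1) (r1 * t1 * (s2 * p2))).
  by apply: eq_Ev2 => t1 t2; rewrite (@R_DeltaL _ (fun x' y' s2 => H (t2 * x') (r2 * y') (r1 * t1 * s2))) //; lintac.
transitivity (\E(p1, p2 <- R) \E(t1, t2 <- R) \E(s1, s2 <- R) H (t2 * s1) (r2 * p1) (r1 * t1 * (s2 * p2))).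
  rewrite [RHS]Ev2_exch; apply: eq_Ev2 => ? ?; exact: Ev2_exch.
apply: eq_Ev2 => p1 p2; rewrite QmE; last by lintac.
mulr_assoc.
Qed.

(** * The ribbon element and the invariance of the integral *)

Local Notation w := (v^-1).

Lemma vC a : v * a = a * v. Proof. by case: HR => h _ _ _ _; apply: h. Qed.
Lemma vV : v * w = 1. Proof. by case: HR => _ h _ _ _; rewrite divrr. Qed.
Lemma Vv : w * v = 1. Proof. by case: HR => _ h _ _ _; rewrite mulVr. Qed.
Lemma wC a : w * a = a * w.
Proof. by rewrite -[LHS]mulr1 -vV !mulrA -(mulrA w a) -(vC a) mulrA Vv mul1r. Qed.
Lemma Sv : S v = v. Proof. by case: HR => _ _ []. Qed.
Lemma Sw : S w = w.
Proof. by rewrite -[LHS]mulr1 -vV mulrA -[X in _ * X * _]Sv -SM vV S1 mul1r. Qed.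
Lemma Sinvv : Sinv v = v. Proof. by rewrite -[in LHS]Sv SK. Qed.
Lemma Sinvw : Sinv w = w. Proof. by rewrite -[in LHS]Sw SK. Qed.
Lemma epsv : eps v = 1. Proof. by case: HR => _ _ []. Qed.
Lemma epsw : eps w = 1.
Proof. by rewrite -[LHS]mul1r -[X in X * _]epsv -epsM vV eps1. Qed.

Lemma Delta_v V (F : A -> A -> V) : bil F ->
  Ev2 F (D v) = \E(q1, q2 <- Qm R) F (v * q1) (v * q2).
Proof.
move=> hF; case: HR => _ _ _ _ ->; rewrite Ev2_tmul // Ev2_pt //.
by lintac.
Qed.

Lemma Qm_v V (F : A -> A -> V) : bil F ->
  Ev2 F (Qm R) = \E(x, y <- D v) F (w * x) (w * y).
Proof.
move=> hF; rewrite Delta_v; last by lintac.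
by apply: eq_Ev2 => x y; rewrite !mulrA Vv !mul1r.
Qed.

(** Meant for v and w, which the antipode fixes. Used twice in a row it gives invariance of Delta(u)
    under S^-2 (x) S^-2. *)
Lemma Delta_flip V (F : A -> A -> V) u : bil F -> Sinv u = u ->
  Ev2 F (D u) = \E(x, y <- D u) F (Sinv y) (Sinv x).
Proof. by move=> hF e; rewrite -[in LHS]e Delta_Sinv. Qed.

Lemma rho_Delta V (f : A -> V) a : lin f -> \E(x, y <- D a) (rho x *: f y) = rho a *: f 1.
Proof.
move=> hf; case: Hrho => _ _ /(_ a) e; rewrite -(linZ _ hf) -e (linEv2 _ _ hf).
by apply: eq_Ev2 => x y; rewrite (linZ _ hf).
Qed.

(** Insert y_(2) S(y_(3)) behind x_(2) and apply the right integral property to x y_(1). *)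
Lemma rho_shift x y :
  \E(x1, x2 <- D x) (rho (x1 * y) *: x2) = \E(y1, y2 <- D y) (rho (x * y1) *: S y2).
Proof.
transitivity (\E(y1, y2 <- D y) \E(p, q <- D (x * y1)) (rho p *: (q * S y2))); last first.
  by apply: eq_Ev2 => y1 y2; rewrite (@rho_Delta _ (fun z => z * S y2)) ?mul1r //; lintac.
transitivity (\E(x1, x2 <- D x) \E(y1, y2 <- D y) \E(p, q <- D y1) (rho (x1 * p) *: (x2 * q * S y2))); last first.
  by rewrite Ev2_exch; apply: eq_Ev2 => y1 y2; rewrite Delta_mul //; lintac.
apply: eq_Ev2 => x1 x2; rewrite coassoc; last by lintac.
rewrite -[X in _ = X](_ : \E(y1, y2 <- D y) \E(p, q <- D y2) (rho (x1 * y1) *: (x2 * (p * S q))) = _); last by mulr_assoc.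
by rewrite (@antipoder_ins _ (fun a b => rho (x1 * a) *: (x2 * b))) ?mulr1 //; lintac.
Qed.

(** * The Fourier transform in degree 0; [coact v] and [coact w] are the maps X and X' above *)

Definition coact (u a : A) : A := \E(x, y <- D a) (rho (u * x) *: y).

Lemma lin_coact u : lin (coact u).
Proof. by rewrite /coact; lintac. Qed.
Hint Resolve lin_coact : linear.

Lemma coactE u a : (forall b, u * b = b * u) ->
  coact u a = \E(x, y <- D u) (rho (a * x) *: S y).
Proof. by move=> hu; rewrite -rho_shift; apply: eq_Ev2 => x y; rewrite hu. Qed.

Definition fourier (a : A) : A := \E(q1, q2 <- Qm R) (rho (a * q1) *: S q2).

Lemma lin_fourier : lin fourier.
Proof. by rewrite /fourier; lintac. Qed.
Hint Resolve lin_fourier : linear.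

Lemma coact_fourier a : coact v a = v * fourier (v * a).
Proof.
rewrite (coactE _ vC) Delta_v; last by lintac.
rewrite /fourier Ev2_mull; apply: eq_Ev2 => x y.
by rewrite SM Sv -(vC (S y)) mulrA -(vC a) scalerAr.
Qed.

Lemma fourier_coact a : fourier a = w * coact v (w * a).
Proof. by rewrite coact_fourier !mulrA Vv vV !mul1r. Qed.

(** Since [Sinv] fixes v and reverses its coproduct, the integral property on the first leg of
    Delta(v) turns into one on the second leg. *)
Lemma Delta_v_rhoS V (f : A -> V) : lin f ->
  \E(x, y <- D v) (rho (S y) *: f x) = rho v *: f 1.
Proof.
move=> hf; rewrite Delta_flip ?Sinvv //; last by lintac.
rewrite -Sinv1 -(@rho_Delta _ (fun z => f (Sinv z))); last by lintac.
by apply: eq_Ev2 => x y; rewrite SinvK.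
Qed.

Lemma Qm_rhoS V (f : A -> V) : lin f ->
  \E(q1, q2 <- Qm R) (rho (v * S q2) *: f q1) = rho v *: f w.
Proof.
move=> hf; rewrite Qm_v; last by lintac.
rewrite -[X in f X]mulr1 -(@Delta_v_rhoS _ (fun z => f (w * z))); last by lintac.
by apply: eq_Ev2 => x y; rewrite SM Sw -wC mulrA vV mul1r.
Qed.

(** Expand Delta(Q_2) by [Q_DeltaR]. The inner Q evaluates by [Qm_rhoS] to rho(v) w in the first
    leg, and R_21 R_12 = Q remains. Through [coact_fourier] this is relation (1) in degree 0. *)
Lemma coact_v_fourier a : coact v (fourier a) = rho v *: fourier (w * a).
Proof.
rewrite {1}/fourier (linEv2 _ _ (lin_coact v)).
transitivity (\E(q1, q2 <- Qm R) \E(x, y <- D q2) (rho (a * q1) *: (rho (v * S y) *: S x))).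
  apply: eq_Ev2 => q1 q2; rewrite (linZ _ (lin_coact v)) -Ev2_scaler /coact Delta_S //.
  by lintac.
rewrite (@Q_DeltaR _ (fun q1 x y => rho (a * q1) *: (rho (v * S y) *: S x))); last by lintac.
rewrite /fourier QmE ?Ev2_scaler; last by lintac.
apply: eq_Ev2 => r1 r2; rewrite Ev2_scaler; apply: eq_Ev2 => s1 s2.
have -> : w * a * (r2 * s1) = a * (r2 * w * s1) by rewrite wC -!mulrA (mulrA w) wC -mulrA.
rewrite -(@Qm_rhoS _ (fun z => rho (a * (r2 * z * s1)) *: S (r1 * s2))); last by lintac.
by apply: eq_Ev2 => q1 q2; rewrite !scalerA mulrC.
Qed.

Lemma fourier_T_fourier a : fourier (v * fourier a) = rho v *: (w * fourier (w * a)).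
Proof.
have := coact_v_fourier a; rewrite coact_fourier => /(congr1 (fun z => w * z)).
by rewrite mulrA Vv mul1r scalerAr.
Qed.

(** * Factorizability, the Nakayama automorphism and the central integral *)

Lemma Phibar_inj (phi psi : A -> K) : scalar phi -> scalar psi ->
  \E(q1, q2 <- Qm R) (phi q1 *: q2) = \E(q1, q2 <- Qm R) (psi q1 *: q2) -> phi =1 psi.
Proof. by case: HF => h _ h1 h2 e b; apply: h. Qed.

(* By [rho_shift], rho(v_1 a) v_2 and rho(a v_1) S^2(v_2) both come from X(a), and
   (S^2 (x) S^2) Delta(v) = Delta(v); factorizability then separates the functionals of v_1. *)
Lemma Nakayama a b : rho (b * a) = rho (a * Sinv (Sinv b)).
Proof.
pose phi c := rho (v * c * a); pose psi c := rho (a * Sinv (Sinv (v * c))).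
have lphi : lin (phi : A -> K^o) by rewrite /phi; lintac.
have lpsi : lin (psi : A -> K^o) by rewrite /psi; lintac.
(* The extra v in both functionals turns Q into Delta(v); the choice c = w b removes it again. *)
suff e : phi =1 psi by have := e (w * b); rewrite /phi /psi mulrA vV mul1r.
apply: Phibar_inj => //; rewrite !Qm_v; [|lintac..].
transitivity (w * \E(x, y <- D v) (rho (x * a) *: y)).
  rewrite Ev2_mull; apply: eq_Ev2 => x y.
  by rewrite /phi mulrA vV mul1r scalerAr.
rewrite rho_shift.
transitivity (w * \E(x, y <- D v) (rho (a * x) *: S (S y))); last first.
  rewrite Ev2_mull Delta_flip ?Sinvv //; last by lintac.
  rewrite Delta_flip ?Sinvv //; last by lintac.
  by apply: eq_Ev2 => x y; rewrite /psi !SinvK mulrA vV mul1r scalerAr.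
congr (_ * _); transitivity (S (coact v a)).
  by rewrite /coact (linEv2 _ _ lin_S); apply: eq_Ev2 => x y; rewrite (linZ _ lin_S).
rewrite (coactE _ vC) (linEv2 _ _ lin_S).
by apply: eq_Ev2 => x y; rewrite (linZ _ lin_S).
Qed.

Lemma Nakayama_S a b : rho (a * b) = rho (S (S b) * a).
Proof. by rewrite [RHS]Nakayama !SK. Qed.

(** Holds because Q = (w (x) w) Delta(v) with v and w central. *)
Lemma Qm_Delta V (F : A -> A -> V) a : bil F ->
  \E(q1, q2 <- Qm R) \E(x, y <- D a) F (q1 * x) (q2 * y) =
  \E(x, y <- D a) \E(q1, q2 <- Qm R) F (x * q1) (y * q2).
Proof.
move=> hF; rewrite Qm_v; last by lintac.
transitivity (\E(x, y <- D (v * a)) F (w * x) (w * y)).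
  by rewrite Delta_mul; [mulr_assoc | lintac].
rewrite vC Delta_mul; last by lintac.
apply: eq_Ev2 => x y; rewrite Qm_v; last by lintac.
by apply: eq_Ev2 => x' y'; rewrite !mulrA (wC x) (wC y).
Qed.

Definition cointegral : A := \E(q1, q2 <- Qm R) (rho q1 *: q2).

(** Write a rho(Q_1) Q_2 as rho(S(a_(1)) a_(2) Q_1) a_(3) Q_2 and commute Q with the coproduct. Then
    [Nakayama_S] brings a_(2) to the front as S^2(a_(2)), where S(a_(1) S(a_(2))) cancels. *)
Lemma cointegralC a : cointegral * a = a * cointegral.
Proof.
pose G x y := \E(q1, q2 <- Qm R) (rho (x * q1) *: (y * q2)).
have hG : bil G by rewrite /G; lintac.
have -> : a * cointegral = G 1 a.
  by rewrite /cointegral Ev2_mull; apply: eq_Ev2 => x y; rewrite mul1r scalerAr.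
rewrite -antipodel_ins // coassoc; last by lintac.
transitivity (\E(a1, a2 <- D a) \E(x, y <- D a2) \E(q1, q2 <- Qm R) (rho (S (a1 * S x) * q1) *: (q2 * y))); last first.
  apply: eq_Ev2 => a1 a2.
  transitivity (\E(x, y <- D a2) \E(q1, q2 <- Qm R) (rho (S a1 * (x * q1)) *: (y * q2))); last by rewrite /G; mulr_assoc.
  rewrite -(@Qm_Delta _ (fun x y => rho (S a1 * x) *: y)); last by lintac.
  rewrite Ev2_exch; apply: eq_Ev2 => q1 q2; apply: eq_Ev2 => x y.
  by rewrite [X in _ = X *: _](_ : _ = rho ((S a1 * q1) * x)) ?mulrA // (Nakayama_S _ x) SM mulrA.
rewrite -coassoc; last by lintac.
transitivity (\E(x, y <- D a) (eps x *: (cointegral * y))).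
  by rewrite (@counitl _ (fun z => cointegral * z)) //; lintac.
apply: eq_Ev2 => x y.
rewrite (@antipoder _ (fun z => \E(q1, q2 <- Qm R) (rho (S z * q1) *: (q2 * y)))); last by lintac.
congr (_ *: _); rewrite /cointegral Ev2_mulr; apply: eq_Ev2 => q1 q2.
by rewrite S1 mul1r scalerAl.
Qed.

(** Integrate the first leg of Delta(Q_1) in two ways: the integral property of rho gives 1 (x)
    [cointegral], while R_32 Q_13 R_23 gives Q (1 (x) [cointegral]) by centrality. *)
Lemma Qm_cointegral V (F : A -> A -> V) : bil F -> \E(q1, q2 <- Qm R) F q1 (q2 * cointegral) = F 1 cointegral.
Proof.
move=> hF; transitivity (\E(q1, q2 <- Qm R) \E(x, y <- D q1) (rho x *: F y q2)); last first.
  rewrite /cointegral (linEv2 (f := F 1)); last by lintac.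
  apply: eq_Ev2 => q1 q2; rewrite (@rho_Delta _ (F^~ q2)); last by lintac.
  by rewrite (linZ _ (proj2 hF 1)).
rewrite (@Q_DeltaL _ (fun x y z => rho x *: F y z)); last by lintac.
rewrite QmE; last by lintac.
apply: eq_Ev2 => r1 r2; apply: eq_Ev2 => s1 s2.
rewrite -mulrA -cointegralC mulrA /cointegral Ev2_mull Ev2_mulr (linEv2 (f := F (r2 * s1))); last by lintac.
by apply: eq_Ev2 => q1 q2; rewrite -scalerAr -scalerAl (linZ _ (proj2 hF _)).
Qed.

Lemma eps_Qm : \E(q1, q2 <- Qm R) (eps q2 *: q1) = 1.
Proof.
rewrite Qm_v; last by lintac.
rewrite (eq_Ev2 (G := fun x y => eps y *: (w * x))) => [|x y]; last by rewrite epsM epsw mul1r.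
by rewrite (@counitr _ (fun x => w * x)) ?Vv //; lintac.
Qed.

(** By factorizability a = phi(Q_1) Q_2 for some phi. Then [Qm_cointegral] yields the scalar phi(1),
    which is eps(a) by [eps_Qm]. *)
Lemma mul_cointegral a : a * cointegral = eps a *: cointegral.
Proof.
have [phi [lphi <-]] : exists phi : A -> K, scalar phi /\ Phibar R phi = a by case: HF.
have {lphi} lphi : lin (phi : A -> K^o) by [].
rewrite /Phibar Ev2_mulr (linEv2 (V := A) (W := K^o) (f := eps)) ?lin_eps //; last by lintac.
transitivity (phi 1 *: cointegral).
  rewrite -(@Qm_cointegral _ (fun x y => phi x *: y)); last by lintac.
  by apply: eq_Ev2 => q1 q2; rewrite scalerAl.
congr (_ *: _); rewrite -[X in phi X]eps_Qm (linEv2 (f := (phi : A -> K^o))); last by lintac.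
apply: (@eq_Ev2 _ _ K^o) => q1 q2.
by rewrite (linZ _ lphi) (linZ _ lin_eps) /GRing.scale /= mulrC.
Qed.

(** Both sides equal rho(a [Sinv cointegral]): on the left by flipping Delta(v) and using
    [cointegral] = v [cointegral] = rho(w v_(1)) v_(2), on the right because [Sinv cointegral] is
    again an integral. *)
Lemma rho_coact a : rho (w * coact v a) = eps a * rho (Sinv cointegral).
Proof.
transitivity (rho (a * Sinv cointegral)); last first.
  have -> : a * Sinv cointegral = eps a *: Sinv cointegral.
    by apply: (can_inj SK); rewrite SM SinvK cointegralC mul_cointegral epsS (linZ _ lin_S) SinvK.
  by rewrite (linZ _ lin_rho).
rewrite (coactE _ vC) Delta_flip ?Sinvv; [|by lintac|by []].
have -> : cointegral = \E(x, y <- D v) (rho (w * x) *: y).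
  transitivity (v * cointegral); first by rewrite mul_cointegral epsv scale1r.
  rewrite /cointegral Qm_v ?Ev2_mull; last by lintac.
  by apply: eq_Ev2 => x y; rewrite -scalerAr mulrA vV mul1r.
rewrite (linEv2 _ _ lin_Sinv) !Ev2_mull !(linEv2 _ _ lin_rho).
apply: (@eq_Ev2 _ _ K^o) => x y.
by rewrite SinvK (linZ _ lin_Sinv) -!scalerAr !(linZ _ lin_rho) /GRing.scale /= mulrC.
Qed.

(** By coassociativity the composite is rho(v a_(1)) rho(w a_(2)) a_(3), and [rho_coact] applies to
    the first two components. *)
Lemma coact_coact a : coact w (coact v a) = rho (Sinv cointegral) *: a.
Proof.
rewrite {2}/coact (linEv2 _ _ (lin_coact w)).
transitivity (\E(x, y <- D a) \E(x1, x2 <- D x) (rho (v * x1) *: (rho (w * x2) *: y))).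
  rewrite coassoc; last by lintac.
  by apply: eq_Ev2 => x y; rewrite (linZ _ (lin_coact w)) /coact Ev2_scaler.
rewrite -(@counitl _ (fun z => rho (Sinv cointegral) *: z)); last by lintac.
apply: eq_Ev2 => x y; rewrite scalerA -rho_coact /coact Ev2_mull (linEv2 _ _ lin_rho).
rewrite [RHS](linEv2 (V := K^o) (f := fun z => z *: y)); last by lintac.
by apply: eq_Ev2 => x1 x2; rewrite scalerA -scalerAr (linZ _ lin_rho).
Qed.

Lemma rhorhoQE : rhorhoQ R rho = rho cointegral.
Proof.
rewrite /cointegral (linEv2 _ _ lin_rho); apply: (@eq_Ev2 _ _ K^o) => x y.
by rewrite (linZ _ lin_rho).
Qed.

(** Evaluate [coact_coact] at [cointegral] itself: [coact v] sends it to rho([cointegral]) v, and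
    [coact w] sends v back to it. The two scalars agree since [cointegral] is nonzero. *)
Lemma rho_Sinv_cointegral : rho (Sinv cointegral) = rho cointegral.
Proof.
have cointegralN0 : cointegral != 0.
  (* Otherwise [Phibar] would send rho and 0 to the same element, forcing rho = 0. *)
  apply/negP => /eqP cointegral0; have [lr [a ra] _] := Hrho; move/negP: ra; apply; apply/eqP.
  apply: (@Phibar_inj rho (fun=> 0)) => //; first by move=> k u u'; rewrite mulr0 addr0.
  by rewrite [LHS]cointegral0 -[RHS](eq_Ev2 (F := fun _ _ => 0)) ?[RHS]big1 // => *; rewrite ?scale0r ?scaler0.
have e1 : coact v cointegral = rho cointegral *: v.
  rewrite (coactE _ vC) -[in RHS]Sv -(@counitl _ (fun z => rho cointegral *: S z)); last by lintac.
  by apply: eq_Ev2 => x y; rewrite cointegralC mul_cointegral (linZ _ lin_rho) scalerA.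
have e2 : coact w v = cointegral.
  transitivity (v * cointegral); last by rewrite mul_cointegral epsv scale1r.
  rewrite /cointegral Qm_v ?Ev2_mull; last by lintac.
  by apply: eq_Ev2 => x y; rewrite -scalerAr mulrA vV mul1r.
have := coact_coact cointegral; rewrite e1 (linZ _ (lin_coact w)) e2 => /eqP.
by rewrite -subr_eq0 -scalerBl scaler_eq0 (negPf cointegralN0) orbF subr_eq0 => /eqP ->.
Qed.

(** * The action [act] and its compatibility with [coact] *)

Definition act (a m : A) : A := \E(x, y <- D a) (y * m * Sinv x).

Lemma lin_act a : lin (act a).
Proof. by rewrite /act; lintac. Qed.

Lemma Sinvl_ins V (G : A -> A -> V) a : bil G ->
  \E(x, y <- D a) \E(y1, y2 <- D y) G x (Sinv y2 * y1) = G a 1.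
Proof.
move=> hG; rewrite -(@counitr _ (fun z => G z 1)); last by lintac.
by apply: eq_Ev2 => x y; rewrite (@Sinvl _ (G x)); last by lintac.
Qed.

(** In rho(u a_(3) m_(1) S^-1(a_(2))) the Nakayama identity moves a_(3) to the end as S^-2(a_(3)),
    where S^-1(S^-1(a_(3)) a_(2)) cancels. What remains is a_(1) and a_(4) around the output. *)
Lemma coact_act u a m : (forall b, u * b = b * u) ->
  coact u (act a m) = act a (coact u m).
Proof.
move=> hu; rewrite {1}/act (linEv2 _ _ (lin_coact u)).
pose G s t p q := \E(m1, m2 <- D m) (rho (u * m1 * Sinv (Sinv p * t)) *: (q * m2 * Sinv s)).
transitivity (\E(x, y <- D a) \E(s, t <- D x) \E(p, q <- D y) G s t p q).
  apply: eq_Ev2 => x y; rewrite /coact Delta_mul; last by lintac.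
  rewrite (eq_Ev2 (G := fun p q => \E(s, t <- D x) rho (u * (p * Sinv t)) *: (q * Sinv s))); last first.
    by move=> p q; rewrite Delta_Sinv //; lintac.
  rewrite Delta_mul; last by lintac.
  transitivity (\E(p, q <- D y) \E(s, t <- D x) G s t p q); last by rewrite Ev2_exch.
  apply: eq_Ev2 => p q; rewrite Ev2_exch; apply: eq_Ev2 => s t; rewrite /G; apply: eq_Ev2 => m1 m2.
  by rewrite (mulrA u) (mulrA u) hu -!mulrA (Nakayama _ p) SinvM !mulrA.
rewrite coassoc; last by rewrite /G; lintac.
transitivity (\E(x, y <- D a) \E(z, q <- D y) \E(t, p <- D z) G x t p q).
  by apply: eq_Ev2 => x y; rewrite coassoc //; rewrite /G; lintac.
transitivity (\E(x, y <- D a) G x 1 1 y).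
  apply: eq_Ev2 => x y; rewrite -(@counitl _ (fun q => G x 1 1 q)); last by rewrite /G; lintac.
  apply: eq_Ev2 => z q.
  rewrite (@Sinvl _ (fun c => \E(m1, m2 <- D m) (rho (u * m1 * Sinv c) *: (q * m2 * Sinv x)))); last by lintac.
  by rewrite /G !(Sinv1, mulr1).
rewrite /act; apply: eq_Ev2 => x y; rewrite /coact Ev2_mull Ev2_mulr; apply: eq_Ev2 => m1 m2.
by rewrite !(Sinv1, mulr1) -scalerAr -scalerAl.
Qed.

(** * The Drinfel'd element and the fourth power of [fourier] *)

Local Notation u := (drinfeld_u S R).

(** Insert S(a_(2) S(a_(3))), move R past the coproduct of a by [R_Delta], and cancel S(a_(1))
    a_(2). *)
Lemma drinfeldE a : u * a = S (S a) * u.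
Proof.
transitivity (\E(x, y <- D a) \E(x1, x2 <- D x) \E(r1, r2 <- R) (S (S y) * S (r2 * x2) * (r1 * x1))).
  rewrite coassoc; last by lintac.
  transitivity (\E(x, y <- D a) \E(y1, y2 <- D y) \E(r1, r2 <- R) (S (y1 * S y2) * S r2 * (r1 * x))).
    rewrite (@antipoder_ins _ (fun x y => \E(r1, r2 <- R) (S y * S r2 * (r1 * x)))); last by lintac.
    by rewrite /drinfeld_u Ev2_mulr S1; apply: eq_Ev2 => x y; rewrite mul1r mulrA.
  do 2![apply: eq_Ev2 => ? ?]; apply: eq_Ev2 => r1 r2.
  by rewrite !SM !mulrA.
transitivity (\E(x, y <- D a) \E(x1, x2 <- D x) \E(r1, r2 <- R) (S (S y) * S (x1 * r2) * (x2 * r1))).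
  apply: eq_Ev2 => x y; rewrite Ev2_exch.
  rewrite (@R_Delta _ (fun p q => S (S y) * S q * p)) //; lintac.
transitivity (\E(x, y <- D a) \E(x1, x2 <- D x) \E(r1, r2 <- R) (S (S y) * S r2 * (S x1 * x2) * r1)).
  by do 3![apply: eq_Ev2 => ? ?]; rewrite SM !mulrA.
rewrite (@antipodel_ins _ (fun x y => \E(r1, r2 <- R) (S (S y) * S r2 * x * r1))); last by lintac.
by rewrite /drinfeld_u Ev2_mull; apply: eq_Ev2 => x y; rewrite mulr1 mulrA.
Qed.

Lemma S_drinfeldE a : S u * S (S a) = a * S u.
Proof.
have := congr1 S (drinfeldE (Sinv a)).
by rewrite !SM !SinvK => ->.
Qed.

(** The ribbon axiom gives u S(u) = w w, the opposite order. Since S(u) S^2(u) = u S(u) by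
    [S_drinfeldE], comparing inverses gives S^2(u) = u. *)
Lemma S_drinfeld_mul : S u * u = w * w.
Proof.
have e1 : u * S u = w * w.
  by case: HR => _ _ _ e _; rewrite -[u * S u]invrK -e -exprVn expr2.
have e2 : S u * S (S u) = w * w by rewrite S_drinfeldE.
have vvww : v * v * (w * w) = 1 by rewrite -mulrA (mulrA v w) vV mul1r vV.
have e3 : v * v * u * S u = 1 by rewrite -mulrA e1 vvww.
suff SSu : S (S u) = u by rewrite -{2}SSu.
by rewrite -[LHS]mul1r -e3 -mulrA e2 -(mulrA v) !vC -!mulrA (mulrA v) vvww mulr1.
Qed.

Definition braid (m : A) : A := \E(r1, r2 <- R) (r2 * S m * u * r1).

Lemma lin_braid : lin braid.
Proof. by rewrite /braid; lintac. Qed.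

(** Splitting Delta(R_2) produces a second copy of R that assembles into u. In this form [braid] can
    be commuted past [coact w]. *)
Lemma braid_act m : braid m = \E(r1, r2 <- R) (S (act r2 m) * r1).
Proof.
transitivity (\E(r1, r2 <- R) \E(x, y <- D r2) (S (y * m * Sinv x) * r1)); last first.
  by apply: eq_Ev2 => r1 r2; rewrite /act (linEv2 _ _ lin_S) Ev2_mulr.
rewrite (@R_DeltaR _ (fun r1 x y => S (y * m * Sinv x) * r1)); last by lintac.
rewrite Ev2_exch; apply: eq_Ev2 => s1 s2; rewrite /drinfeld_u Ev2_mull Ev2_mulr.
by apply: eq_Ev2 => r1 r2; rewrite !SM SinvK !mulrA.
Qed.

(* That is, Q^-1 R_21 = R^-1. *)
Lemma Delta_w_R V (F : A -> A -> V) : bil F ->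
  \E(x, y <- D w) \E(r1, r2 <- R) F (x * r2) (y * r1) = \E(r1, r2 <- R) F (w * S r1) (w * r2).
Proof.
move=> hF; transitivity (\E(t1, t2 <- R) \E(x, y <- D (w * v)) F (w * x * S t1) (w * y * t2)); last first.
  by apply: eq_Ev2 => t1 t2; rewrite Vv Delta_one ?mulr1 //; lintac.
transitivity (\E(x, y <- D w) \E(r1, r2 <- R) \E(s1, s2 <- R) \E(t1, t2 <- R) F (x * (r2 * s1) * S t1) (y * (r1 * s2) * t2)).
  apply: eq_Ev2 => x y; apply: eq_Ev2 => r1 r2.
  transitivity (F (x * r2 * 1) (y * r1 * 1)); first by rewrite !mulr1.
  by rewrite -(@R_Sr _ (fun a b => F (x * r2 * a) (y * r1 * b))); [mulr_assoc | lintac].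
transitivity (\E(t1, t2 <- R) \E(x, y <- D w) \E(r1, r2 <- R) \E(s1, s2 <- R) F (x * (r2 * s1) * S t1) (y * (r1 * s2) * t2)).
  rewrite [RHS]Ev2_exch; apply: eq_Ev2 => x y.
  rewrite [RHS]Ev2_exch; apply: eq_Ev2 => r1 r2; exact: Ev2_exch.
apply: eq_Ev2 => t1 t2; rewrite Delta_mul; last by lintac.
apply: eq_Ev2 => x y.
rewrite -(@QmE _ (fun a b => F (x * a * S t1) (y * b * t2))); last by lintac.
rewrite Qm_v; last by lintac.
by apply: eq_Ev2 => x' y'; rewrite !mulrA -!wC.
Qed.

(* That is, Q^-1 = R^-1 R_21^-1. *)
Lemma Delta_w V (F : A -> A -> V) : bil F ->
  Ev2 F (D w) = \E(t1, t2 <- R) \E(s1, s2 <- R) F (w * S t1 * s2) (w * t2 * S s1).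
Proof.
move=> hF.
rewrite -(@Delta_w_R _ (fun a b => \E(s1, s2 <- R) F (a * s2) (b * S s1))); last by lintac.
apply: eq_Ev2 => x y.
transitivity (F (x * 1) (y * 1)); first by rewrite !mulr1.
by rewrite -(@R_Sr _ (fun a b => F (x * b) (y * a))); [mulr_assoc | lintac].
Qed.

(** Since [coact w] commutes with [act], the sum involves Delta(w) and, after Delta(R_2) is split,
    two copies of R. [Delta_w_R] absorbs one of them into Delta(w), and the result combines with the
    other into Q, that is, into Delta(v). *)
Lemma braid_coact a : braid (coact w a) = w * w * coact v (w * w * a).
Proof.
rewrite braid_act.
transitivity (\E(s1, s2 <- R) \E(r1, r2 <- R) \E(p, q <- D w)
    (rho (a * Sinv s2 * p * Sinv (Sinv r2)) *: (S (S q) * r1 * s1))).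
  transitivity (\E(r1, r2 <- R) \E(x, y <- D r2) \E(p, q <- D w)
     (rho (y * a * Sinv x * p) *: (S (S q) * r1))).
    apply: eq_Ev2 => r1 r2; rewrite -coact_act; last exact: wC.
    rewrite /act (linEv2 _ _ (lin_coact w)) (linEv2 _ _ lin_S) Ev2_mulr.
    apply: eq_Ev2 => x y; rewrite (coactE _ wC) (linEv2 _ _ lin_S) Ev2_mulr.
    by apply: eq_Ev2 => p q; rewrite (linZ _ lin_S) scalerAl.
  rewrite (@R_DeltaR _ (fun r1 x y => \E(p, q <- D w) (rho (y * a * Sinv x * p) *: (S (S q) * r1)))); last by lintac.
  rewrite Ev2_exch; do 3![apply: eq_Ev2 => ? ?].
  by rewrite -!mulrA Nakayama !mulrA.
transitivity (\E(s1, s2 <- R) \E(p, q <- D w) \E(r1, r2 <- R)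
    (rho (a * Sinv s2 * Sinv (Sinv (p * r2))) *: (q * r1 * s1))).
  apply: eq_Ev2 => s1 s2; rewrite Ev2_exch.
  rewrite Delta_flip ?Sinvw //; last by lintac.
  rewrite Delta_flip ?Sinvw //; last by lintac.
  apply: eq_Ev2 => p q; apply: eq_Ev2 => r1 r2.
  by rewrite !SinvK !SinvM !mulrA.
transitivity (\E(s1, s2 <- R) \E(r1, r2 <- R) (rho (w * a * Sinv (r1 * s2)) *: (w * (r2 * s1)))).
  apply: eq_Ev2 => s1 s2.
  rewrite (@Delta_w_R _ (fun a' b => rho (a * Sinv s2 * Sinv (Sinv a')) *: (b * s1))); last by lintac.
  apply: eq_Ev2 => r1 r2.
  by rewrite !SinvM SK !Sinvw (wC (Sinv r1)) !mulrA -wC !mulrA.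
rewrite Ev2_exch -(@QmE _ (fun x y => rho (w * a * Sinv y) *: (w * x))); last by lintac.
rewrite Qm_v; last by lintac.
rewrite (coactE _ vC) Ev2_mull [RHS]Delta_flip ?Sinvv //; last by lintac.
apply: eq_Ev2 => x y.
by rewrite SinvK SinvM Sinvw -scalerAr -wC !mulrA -wC !mulrA.
Qed.

(** One factor is written as w X w and the other as v Y X' v; in the composite X' meets X, and X' X
    is a scalar. *)
Lemma fourier_sq a : fourier (fourier a) = rho cointegral *: braid a.
Proof.
have braidv m : braid (v * m) = v * braid m.
  rewrite /braid Ev2_mull; apply: eq_Ev2 => x y.
  by rewrite SM Sv -vC !mulrA vC.
have fourE b : fourier b = v * braid (coact w (v * b)).
  by rewrite braid_coact fourier_coact !mulrA vV mul1r -!mulrA (mulrA w v) Vv mul1r.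
rewrite fourE fourier_coact !mulrA vV mul1r coact_coact rho_Sinv_cointegral.
by rewrite (linZ _ lin_braid) -scalerAr -braidv mulrA vV mul1r.
Qed.

(** Conjugation by u and S(u) removes the squares of S and brings S(u) u = w w together; the two
    copies of R are then those in the formula [Delta_w]. *)
Lemma braid_braid b : braid (braid b) = act w b.
Proof.
rewrite /act Delta_w; last by lintac.
rewrite {1}/braid; apply: eq_Ev2 => r1 r2.
rewrite (linEv2 (f := fun m => r2 * S m * u * r1)); last by lintac.
apply: eq_Ev2 => s1 s2; have e : S s2 * u = u * Sinv s2 by rewrite drinfeldE SinvK.
rewrite !SM.
transitivity (r2 * S s1 * (S u * S (S b)) * (S s2 * u) * r1); first by rewrite !mulrA.
rewrite S_drinfeldE e.
transitivity (r2 * S s1 * b * (S u * u) * Sinv s2 * r1); first by rewrite !mulrA.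
by rewrite S_drinfeld_mul !SinvM SK Sinvw -!mulrA -!wC !mulrA -!wC !mulrA.
Qed.

Lemma fourier_pow4 a : fourier (fourier (fourier (fourier a))) = rhorhoQ R rho ^+ 2 *: act w a.
Proof.
by rewrite rhorhoQE !fourier_sq (linZ _ lin_braid) braid_braid scalerA.
Qed.

(* The paper's formulas with all components multiplied out: untwist f is
   f(a_(2)) S^-1(prod a_(1)), twist f is f(a_(2)) prod a_(1). *)
Fixpoint untwist (f : seq A -> A) (s : seq A) : A :=
  if s is a :: s' then \E(x, y <- D a) (untwist (fun l => f (y :: l)) s' * Sinv x) else f [::].

Fixpoint twist (f : seq A -> A) (s : seq A) : A :=
  if s is a :: s' then \E(x, y <- D a) twist (fun l => f (y :: l) * x) s' else f [::].

Lemma eq_untwist f g s : (forall l, size l = size s -> f l = g l) -> untwist f s = untwist g s.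
Proof.
elim: s f g => [|a s IH] f g e /=; first exact: e.
by apply: eq_Ev2 => x y; congr (_ * _); apply: IH => l sz; apply: e; rewrite /= sz.
Qed.

Lemma eq_twist f g s : (forall l, size l = size s -> f l = g l) -> twist f s = twist g s.
Proof.
elim: s f g => [|a s IH] f g e /=; first exact: e.
by apply: eq_Ev2 => x y; apply: IH => l sz; rewrite e //= sz.
Qed.

Lemma lin_untwist V (F : V -> seq A -> A) s :
  (forall l, size l = size s -> lin (fun c => F c l)) -> lin (fun c => untwist (F c) s).
Proof.
elim: s F => [|a s IH] F h /=; first exact: h.
apply: lin_Ev2 => x y; apply: lin_mulr; apply: (IH (fun c l => F c (y :: l))) => l sz.
by apply: h; rewrite /= sz.
Qed.

Lemma lin_twist V (F : V -> seq A -> A) s :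
  (forall l, size l = size s -> lin (fun c => F c l)) -> lin (fun c => twist (F c) s).
Proof.
elim: s F => [|a s IH] F h /=; first exact: h.
apply: lin_Ev2 => x y; apply: (IH (fun c l => F c (y :: l) * x)) => l sz.
by apply: lin_mulr; apply: h; rewrite /= sz.
Qed.

Lemma mlin_untwist n f : mlin n (untwist f).
Proof.
elim: n f => //= n IH f; split=> [s _ | a]; first by lintac.
apply: mlin_Ev2 => x y; apply: (mlin_comp (f := fun z => z * Sinv x)); first by lintac.
exact: IH.
Qed.

Lemma mlin_twist n f : mlin n (twist f).
Proof.
by elim: n f => //= n IH f; split=> [s _ | a]; [lintac | apply: mlin_Ev2].
Qed.

Lemma untwistB f g s : untwist (fun l => f l - g l) s = untwist f s - untwist g s.
Proof.
elim: s f g => //= a s IH f g; rewrite -Ev2B; apply: eq_Ev2 => x y.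
by rewrite (IH (fun l => f (y :: l))) mulrBl.
Qed.

Lemma untwist_comp (h : A -> A) f s : lin h -> (forall x y, h (x * y) = h x * y) ->
  untwist (fun l => h (f l)) s = h (untwist f s).
Proof.
move=> hl hm; elim: s f => //= a s IH f; rewrite (linEv2 _ _ hl).
by apply: eq_Ev2 => x y; rewrite (IH (fun l => f (y :: l))) hm.
Qed.

Lemma untwistM c f s : untwist (fun l => c * f l) s = c * untwist f s.
Proof. by apply: (untwist_comp (h := fun z => c * z)) => [|x y]; [lintac | rewrite mulrA]. Qed.

Lemma untwist_Ev2 (G : A -> A -> seq A -> A) t s :
  untwist (fun l => \E(x, y <- t) G x y l) s = \E(x, y <- t) untwist (G x y) s.
Proof.
elim: s G => //= a s IH G; rewrite [RHS]Ev2_exch; apply: eq_Ev2 => x y.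
by rewrite (IH (fun p q l => G p q (y :: l))) Ev2_mulr.
Qed.

Lemma twist_Ev2 (G : A -> A -> seq A -> A) t s :
  twist (fun l => \E(x, y <- t) G x y l) s = \E(x, y <- t) twist (G x y) s.
Proof.
elim: s G => //= a s IH G; rewrite [RHS]Ev2_exch; apply: eq_Ev2 => x y.
rewrite -(IH (fun p q l => G p q (y :: l) * x)); apply: eq_twist => l _.
by rewrite Ev2_mulr.
Qed.

(** Argument by argument this rests on S^-1(a_(2)) a_(1) = eps(a); the reverse composite rests on
    a_(2) S^-1(a_(1)) = eps(a). *)
Lemma untwistK n f s : mlin n f -> size s = n -> twist (untwist f) s = f s.
Proof.
elim: s n f => //= a s IH [|n] // f [fl fm] [sz].
transitivity (\E(x, y <- D a) \E(y1, y2 <- D y) twist (fun l => untwist (fun l' => f (y2 :: l')) l * (Sinv y1 * x)) s).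
  apply: eq_Ev2 => x y; rewrite -twist_Ev2; apply: eq_twist => l _.
  by rewrite Ev2_mulr; apply: eq_Ev2 => ? ?; rewrite mulrA.
have tl x : lin (fun c => twist (fun l => untwist (fun l' => f (c :: l')) l * x) s).
  apply: (lin_twist (F := fun c l => untwist (fun l' => f (c :: l')) l * x)) => l szl; apply: lin_mulr.
  apply: (lin_untwist (F := fun c l' => f (c :: l'))) => l' szl'; apply: fl.
  by rewrite szl' szl.
rewrite -coassoc; last first.
  split=> [y z | x z | x y]; last exact: tl.
    by apply: (lin_twist (F := fun x l => untwist _ l * (Sinv _ * x))) => l szl; lintac.
  by apply: (lin_twist (F := fun z l => untwist _ l * (Sinv z * _))) => l szl; lintac.
rewrite -[RHS](@counitl _ (fun y => f (y :: s))); last exact: fl.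
apply: eq_Ev2 => x y.
rewrite (@Sinvl _ (fun z => twist (fun l => untwist (fun l' => f (y :: l')) l * z) s)); last first.
  by apply: (lin_twist (F := fun z l => untwist _ l * z)) => l szl; lintac.
rewrite -(IH _ _ (fm y) sz); congr (_ *: _).
by apply: eq_twist => l _; rewrite mulr1.
Qed.

Lemma twistK n f s : mlin n f -> size s = n -> untwist (twist f) s = f s.
Proof.
elim: s n f => //= a s IH [|n] // f [fl fm] [sz].
transitivity (\E(x, y <- D a) \E(y1, y2 <- D y) (f (y2 :: s) * (y1 * Sinv x))).
  apply: eq_Ev2 => x y; rewrite untwist_Ev2 Ev2_mulr; apply: eq_Ev2 => y1 y2.
  rewrite (IH n) // ?mulrA //.
  by apply: (mlin_comp (f := fun z => z * y1)); [lintac | exact: fm].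
have hf := fl s sz.
rewrite -coassoc; last by split=> [y z | x z | x y]; lintac; apply: (lin_comp (g := fun z => z * _)) => //; lintac.
rewrite -[RHS](@counitl _ (fun y => f (y :: s))) //.
apply: eq_Ev2 => x y.
by rewrite (@Sinvr _ (fun z => f (y :: s) * z)) ?mulr1 //; lintac.
Qed.

(** * Multi-Sweedler sums and frakS on sequences *)

Lemma eq_sw3 V (F G : seq A -> seq A -> seq A -> V) s :
  (forall l1 l2 l3, size l2 = size s -> F l1 l2 l3 = G l1 l2 l3) -> sw3 D s F = sw3 D s G.
Proof.
elim: s F G => [|a s IH] F G e /=; first exact: e.
by apply: eq_Ev3 => x y z; apply: IH => l1 l2 l3 sz; apply: e; rewrite /= sz.
Qed.

Lemma lin_sw3 V W (F : W -> seq A -> seq A -> seq A -> V) s :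
  (forall l1 l2 l3, size l2 = size s -> lin (fun c => F c l1 l2 l3)) ->
  lin (fun c => sw3 D s (F c)).
Proof.
elim: s F => [|a s IH] F h /=; first exact: h.
apply: lin_Ev3 => x y z; apply: (IH (fun c l1 l2 l3 => F c (x :: l1) (y :: l2) (z :: l3))).
by move=> l1 l2 l3 sz; apply: h; rewrite /= sz.
Qed.

Lemma linsw3 V W (f : V -> W) (F : seq A -> seq A -> seq A -> V) s :
  lin f -> f (sw3 D s F) = sw3 D s (fun l1 l2 l3 => f (F l1 l2 l3)).
Proof.
move=> hf; elim: s F => //= a s IH F; rewrite (linEv3 _ _ hf).
by apply: eq_Ev3 => x y z; rewrite IH.
Qed.

Lemma lin_Delta3 : lin (Delta3 D).
Proof. by move=> k x y; rewrite /Delta3 lin_Delta /DeltaL Ev2_lint. Qed.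

Lemma mlin_sw3 V n (F : seq A -> seq A -> seq A -> V) : mlin n (fun s => sw3 D s F).
Proof.
elim: n F => //= n IH F; split=> [s _ k x y | a].
  by rewrite lin_Delta3 Ev3_lint.
rewrite /Ev3; elim: (index_enum _) => [|p r IHr].
  by apply: eq_mlin (@mlin_comp _ _ _ _ n _ (fun z => 0 *: z) _ (IH F)) => [s _|]; [rewrite big_nil scale0r | lintac].
pose h (s : seq A) := sw3 D s (fun l1 l2 l3 => F (bv p.1.1 :: l1) (bv p.1.2 :: l2) (bv p.2 :: l3)).
pose tail (s : seq A) := \sum_(i <- r) (Delta3 D a i : K) *: sw3 D s (fun l1 l2 l3 => F (bv i.1.1 :: l1) (bv i.1.2 :: l2) (bv i.2 :: l3)).
have hh : mlin n (fun s => (Delta3 D a p : K) *: h s).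
  by apply: (mlin_comp (f := fun z => (Delta3 D a p : K) *: z)); [lintac | exact: IH].
(* The sum is written as a difference with the negated tail, so that [mlin_sub] applies. *)
have ht : mlin n (fun s => -1 *: tail s).
  by apply: (mlin_comp (f := fun z => -1 *: z)); [lintac | exact: IHr].
by apply: eq_mlin (mlin_sub hh ht) => s _; rewrite big_cons scaleN1r opprK.
Qed.

Definition seqS (h : seq A -> A) (s : seq A) : A :=
  sw3 D s (fun l1 l2 l3 => prodl l1 * S (h l2) * prodl l3).

Definition seqPhi (f : seq A -> A) (s : seq A) : A :=
  sw3 D s (fun l1 l2 l3 => \E(q1, q2 <- Qm R)
    (rho (f l2 * (q1 * prodl (rev (map Sinv l1)))) *: (prodl l3 * q2))).

Lemma eq_seqS h h' s : (forall l, size l = size s -> h l = h' l) -> seqS h s = seqS h' s.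
Proof. by move=> e; apply: eq_sw3 => l1 l2 l3 sz; rewrite e. Qed.

Lemma lin_seqS V (F : V -> seq A -> A) s :
  (forall l, size l = size s -> lin (fun c => F c l)) -> lin (fun c => seqS (F c) s).
Proof.
move=> h; apply: lin_sw3 => l1 l2 l3 sz; have := h _ sz => hl.
apply: lin_mulr; apply: lin_mull; exact: lin_comp lin_S hl.
Qed.

Lemma lin_seqPhi V (F : V -> seq A -> A) s :
  (forall l, size l = size s -> lin (fun c => F c l)) -> lin (fun c => seqPhi (F c) s).
Proof.
move=> h; apply: lin_sw3 => l1 l2 l3 sz; have hl := h _ sz.
apply: lin_Ev2 => q1 q2; apply: lin_scalel; apply: (lin_comp lin_rho).
exact: lin_mulr.
Qed.

Lemma prodl_rcons (l : seq A) c : prodl (rcons l c) = prodl l * c.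
Proof. by elim: l => [|x l IH] /=; rewrite ?mulr1 ?mul1r // IH mulrA. Qed.

(** The factor a_(3) standing after S(h) is pulled into the antipode as S^-1(a_(3)), so that the
    tail is again a value of [seqS]. *)
Lemma seqS_cons n h a s : mlin n.+1 h -> size s = n ->
  seqS h (a :: s) = \E(u, z <- D a) \E(x, y <- D u) (x * seqS (fun l => Sinv z * h (y :: l)) s).
Proof.
move=> [hl _] sz; rewrite -(@Ev3_DeltaL _ _ _ D (fun x y z => x * seqS (fun l => Sinv z * h (y :: l)) s)); last first.
  split=> [y z | x z | x y]; first by lintac.
    apply: lin_mull; apply: (lin_seqS (F := fun y l => Sinv z * h (y :: l))) => l szl; apply: lin_mull.
    by apply: hl; rewrite szl.
  apply: lin_mull; apply: (lin_seqS (F := fun z l => Sinv z * h (y :: l))) => l szl.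
  by lintac.
apply: eq_Ev3 => x y z.
rewrite [RHS](linsw3 (f := fun c => x * c)); last by lintac.
by apply: eq_sw3 => l1 l2 l3 _; rewrite /= SM SinvK !mulrA.
Qed.

(** S^-1(a_(1)) is the last factor under rho; [Nakayama_S] brings it to the front as S(a_(1)). *)
Lemma seqPhi_cons n f a s : mlin n.+1 f -> size s = n ->
  seqPhi f (a :: s) = \E(u, z <- D a) \E(x, y <- D u) (z * seqPhi (fun l => S x * f (y :: l)) s).
Proof.
move=> [hl _] sz; rewrite -(@Ev3_DeltaL _ _ _ D (fun x y z => z * seqPhi (fun l => S x * f (y :: l)) s)); last first.
  split=> [y z | x z | x y]; last by lintac.
    by apply: lin_mull; apply: (lin_seqPhi (F := fun x l => S x * f (y :: l))) => l szl; lintac.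
  apply: lin_mull; apply: (lin_seqPhi (F := fun y l => S x * f (y :: l))) => l szl; apply: lin_mull.
  by apply: hl; rewrite szl.
apply: eq_Ev3 => x y z.
rewrite [RHS](linsw3 (f := fun c => z * c)); last by lintac.
apply: eq_sw3 => l1 l2 l3 _; rewrite Ev2_mull; apply: eq_Ev2 => q1 q2.
by rewrite /= rev_cons prodl_rcons !mulrA Nakayama_S SinvK -scalerAr !mulrA.
Qed.

Lemma seqS_Ev2 (F : A -> A -> seq A -> A) t s :
  seqS (fun l => \E(x, y <- t) F x y l) s = \E(x, y <- t) seqS (F x y) s.
Proof.
have sw (G : A -> A -> seq A -> seq A -> seq A -> A) :
    sw3 D s (fun l1 l2 l3 => \E(x, y <- t) G x y l1 l2 l3) = \E(x, y <- t) sw3 D s (G x y).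
  elim: s G => //= a s IH G; rewrite -Ev3_Ev2; apply: eq_Ev3 => x y z.
  exact: (IH (fun p q l1 l2 l3 => G p q (x :: l1) (y :: l2) (z :: l3))).
rewrite /seqS -sw; apply: eq_sw3 => l1 l2 l3 _.
by rewrite (linEv2 (f := fun z => prodl l1 * S z * prodl l3)) //; lintac.
Qed.

Definition seqfrakS (f : seq A -> A) (s : seq A) : A := seqS (seqPhi f) s.

(* The formula frakS^n(f)(a) = rho(S(a_(2)) f(a_(3)) Q_1) a_(1) S(Q_2), peeled off one argument
   at a time; the third component of S^n cancels that of Phibar^n. *)
Lemma seqfrakS_cons n f a s : mlin n.+1 f -> size s = n ->
  seqfrakS f (a :: s) = \E(x, y <- D a) \E(y1, y2 <- D y) (x * seqfrakS (fun l => S y1 * f (y2 :: l)) s).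
Proof.
move=> fl sz; have mP : mlin n.+1 (seqPhi f) by exact: mlin_sw3.
rewrite /seqfrakS (seqS_cons a mP sz).
pose H c x y := seqS (fun l => c * seqPhi (fun l' => S x * f (y :: l')) l) s.
have hH : tri H.
  split=> [x y | c y | c x].
  - by apply: (lin_seqS (F := fun c l => c * seqPhi (fun l' => S x * f (y :: l')) l)) => l _; lintac.
  - apply: (lin_seqS (F := fun x l => c * seqPhi (fun l' => S x * f (y :: l')) l)) => l _; apply: lin_mull.
    by apply: (lin_seqPhi (F := fun x l' => S x * f (y :: l'))) => l' _; lintac.
  - apply: (lin_seqS (F := fun y l => c * seqPhi (fun l' => S x * f (y :: l')) l)) => l szl; apply: lin_mull.
    apply: (lin_seqPhi (F := fun y l' => S x * f (y :: l'))) => l' szl'; apply: lin_mull.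
    by apply: (proj1 fl); rewrite szl' szl.
transitivity (\E(u, z <- D a) \E(x, y <- D u) \E(w1, z' <- D y) \E(x', y' <- D w1) (x * H (Sinv z * z') x' y')).
  apply: eq_Ev2 => u z; apply: eq_Ev2 => x y.
  transitivity (x * \E(w1, z' <- D y) \E(x', y' <- D w1) H (Sinv z * z') x' y'); last first.
    by rewrite Ev2_mull; apply: eq_Ev2 => w1 z'; rewrite Ev2_mull.
  congr (_ * _); under [RHS]eq_Ev2 => w1 z' do rewrite -seqS_Ev2.
  rewrite -seqS_Ev2; apply: eq_seqS => l szl; rewrite (seqPhi_cons y fl) ?szl // Ev2_mull.
  by apply: eq_Ev2 => w1 z'; rewrite Ev2_mull; apply: eq_Ev2 => x' y'; rewrite mulrA.
rewrite coassoc; last by lintac.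
apply: eq_Ev2 => x y; rewrite coassoc; last by lintac.
rewrite (@Sinvl_ins _ (fun w1 c => \E(x', y' <- D w1) (x * H c x' y'))); last by lintac.
by apply: eq_Ev2 => x' y'; congr (_ * _); apply: eq_seqS => l _; rewrite mul1r.
Qed.

Lemma seqfrakS_nil f : seqfrakS f [::] = fourier (f [::]).
Proof.
rewrite /seqfrakS /seqS /seqPhi /= mul1r mulr1 /fourier (linEv2 _ _ lin_S).
by apply: eq_Ev2 => q1 q2; rewrite (linZ _ lin_S) mulr1 mul1r.
Qed.

Lemma fourier_act a m : fourier (act a m) = act a (fourier m).
Proof.
rewrite !fourier_coact.
have actw x y : act x (w * y) = w * act x y.
  by rewrite /act Ev2_mull; apply: eq_Ev2 => p q; rewrite mulrA -wC !mulrA.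
by rewrite -actw coact_act ?actw //; exact: vC.
Qed.

(** The outer a_(1) of [seqfrakS_cons] and the S^-1 from untwisting form an [act] around [fourier].
    Commuting them by [fourier_act] lets the second half of [act] cancel the antipode inside. *)
Lemma untwist_seqfrakS n f s : mlin n f -> size s = n -> untwist (seqfrakS f) s = fourier (untwist f s).
Proof.
elim: s n f => [|a s IH] [|n] //= f; first by rewrite seqfrakS_nil.
move=> fl [sz]; pose G y := untwist (fun l => f (y :: l)) s.
have hG : lin G by apply: (lin_untwist (F := fun y l => f (y :: l))) => l szl; apply: (proj1 fl); rewrite szl.
transitivity (\E(x, y <- D a) \E(y1, y2 <- D y) \E(z1, z2 <- D y2) (y1 * fourier (S z1 * G z2) * Sinv x)).
  apply: eq_Ev2 => x y.
  rewrite (eq_untwist (g := fun l => \E(y1, y2 <- D y) \E(z1, z2 <- D y2) (y1 * seqfrakS (fun l' => S z1 * f (z2 :: l')) l))); last first.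
    by move=> l szl; exact: (@seqfrakS_cons n f y l fl (etrans szl sz)).
  rewrite untwist_Ev2 Ev2_mulr; apply: eq_Ev2 => y1 y2.
  rewrite untwist_Ev2 Ev2_mulr; apply: eq_Ev2 => z1 z2.
  rewrite untwistM (IH n) // ?untwistM //.
  by apply: (mlin_comp (f := fun z => S z1 * z)); [lintac | exact: (proj2 fl)].
transitivity (\E(x, y <- D a) \E(z1, z2 <- D y) act x (fourier (S z1 * G z2))).
  rewrite -[LHS]coassoc; last by lintac.
  by apply: eq_Ev2 => x y; rewrite Ev2_exch.
transitivity (\E(x, y <- D a) fourier (\E(z1, z2 <- D y) act x (S z1 * G z2))).
  apply: eq_Ev2 => x y; rewrite (linEv2 _ _ lin_fourier).
  by apply: eq_Ev2 => z1 z2; rewrite fourier_act.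
rewrite -(linEv2 _ _ lin_fourier); congr fourier.
transitivity (\E(x, y <- D a) \E(x1, x2 <- D x) \E(z1, z2 <- D y) (x2 * S z1 * (G z2 * Sinv x1))).
  by apply: eq_Ev2 => x y; rewrite /act Ev2_exch; mulr_assoc.
rewrite coassoc; last by lintac.
apply: eq_Ev2 => x y; rewrite -coassoc; last by lintac.
rewrite -[RHS](@counitl _ (fun z => G z * Sinv x)); last by lintac.
apply: eq_Ev2 => u z; rewrite (@antipoder _ (fun c => c * (G z * Sinv x))) ?mul1r //.
by lintac.
Qed.

(** * Untwisting the Hochschild differential *)

Lemma faces_Ev2 V (rt : A -> V -> V) (G : A -> A -> seq A -> V) t s : (forall a, lin (rt a)) ->
  faces rt (fun l => \E(x, y <- t) G x y l) s = \E(x, y <- t) faces rt (G x y) s.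
Proof.
move=> hr; elim: s G => [|a [|b s] IH] G.
- by rewrite /= /Ev2 big1 // => p _; rewrite scaler0.
- by rewrite /= (linEv2 _ _ (hr a)).
by rewrite faces_cons (IH (fun x y l => G x y (a :: l))) -Ev2B.
Qed.

Definition rmul (a m : A) : A := m * a.
Definition triv (a m : A) : A := eps a *: m.
Definition lmul (a m : A) : A := a * m.

Lemma faces_triv_mulr g c s : faces triv (fun l => g l * c) s = faces triv g s * c.
Proof.
elim: s g => [|a [|b s] IH] g; first by rewrite mul0r.
  by rewrite /= /triv scalerAl.
by rewrite !faces_cons (IH (fun l => g (a :: l))) mulrBl.
Qed.

(** Inner faces are respected because Delta is multiplicative and S^-1 antimultiplicative. In the
    last face a_(2) S^-1(a_(1)) = eps(a) trivializes the right action. *)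
Lemma untwist_faces n f s : mlin n f -> size s = n.+1 -> untwist (faces rmul f) s = faces triv (untwist f) s.
Proof.
elim: s n f => // a [|b s] IH n f fl sz.
  transitivity (\E(x, y <- D a) (f [::] * (y * Sinv x))); first by rewrite /= /rmul; mulr_assoc.
  by rewrite (@Sinvr _ (fun z => f [::] * z)) ?mulr1 //; lintac.
case: n fl sz => // n fl [] sz.
pose G y := untwist (fun l => f (y :: l)) s.
have hG : lin G by apply: (lin_untwist (F := fun y l => f (y :: l))) => l szl; apply: (proj1 fl); rewrite szl.
transitivity (\E(x, y <- D a) ((\E(x', y' <- D b) (G (y * y') * Sinv x')
    - faces triv (untwist (fun l => f (y :: l))) (b :: s)) * Sinv x)).
  apply: eq_Ev2 => x y; congr (_ * _); rewrite -(IH n _ (proj2 fl y)); last by rewrite /= sz.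
  (* The default 0 on the empty sequence is never reached, since g is only used on sequences as long
     as [b :: s]. *)
  pose g l := if l is c :: l' then f (y * c :: l') else 0.
  rewrite -[X in X - _]/(untwist g (b :: s)) -untwistB.
  by apply: (@eq_untwist (fun l => faces rmul f (y :: l)) _ (b :: s)) => -[|c l].
rewrite faces_cons (@faces_Ev2 _ triv (fun x y l => untwist (fun l' => f (y :: l')) l * Sinv x)); last first.
  by move=> c; rewrite /triv; lintac.
rewrite -[untwist f (a * b :: s)]/(\E(x, y <- D (a * b)) (G y * Sinv x)).
rewrite Delta_mul -?Ev2B; last by lintac.
apply: eq_Ev2 => x y; rewrite mulrBl faces_triv_mulr; congr (_ - _).
by rewrite Ev2_mulr; apply: eq_Ev2 => x' y'; rewrite SinvM mulrA.
Qed.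

Lemma untwist_seqdiff n f s : mlin n f -> size s = n.+1 ->
  untwist (seqdiff lmul rmul f) s = seqdiff act triv (untwist f) s.
Proof.
move=> fl sz; rewrite /seqdiff untwistB (untwist_faces fl sz); congr (_ - _).
case: s sz => // a s _; rewrite /= /act.
by apply: eq_Ev2 => x y; rewrite /lmul untwistM.
Qed.

Lemma lin_faces V (F : V -> seq A -> A) s :
  (forall l, size l = (size s).-1 -> lin (fun c => F c l)) -> lin (fun c => faces rmul (F c) s).
Proof.
elim: s F => [|a [|b s] IH] F h.
- by move=> k x y /=; rewrite scaler0 addr0.
- by apply: lin_mulr; apply: h.
move=> k x y; rewrite !faces_cons (h (a * b :: s)) // (IH (fun c l => F c (a :: l))) => [|l sz].
  by rewrite scalerBr opprD addrACA.
by apply: h; rewrite /= sz.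
Qed.

Lemma mlin_faces n (f : seq A -> A) : mlin n f -> mlin n.+1 (faces rmul f).
Proof.
elim: n f => [|n IH] f fl; split=> [s sz | a] //.
- by rewrite (size0nil sz) /= /rmul; lintac.
- case: s sz => // b s [sz] k x y.
  rewrite !faces_cons (@lin_faces _ (fun c l => f (c :: l))) => [|l szl]; last by apply: (proj1 fl); rewrite szl.
  by rewrite mulrDl -scalerAl (proj1 fl) // scalerBr opprD addrACA.
pose g l := if l is c :: l' then f (a * c :: l') else 0.
have gl : mlin n.+1 g.
  split=> [s sz | c]; last exact: (proj2 fl).
  by move=> k x y; rewrite /g mulrDr -scalerAr (proj1 fl).
by apply: eq_mlin (mlin_sub gl (IH _ (proj2 fl a))) => -[|b s].
Qed.

Lemma mlin_seqdiff n (f : seq A -> A) : mlin n f -> mlin n.+1 (seqdiff lmul rmul f).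
Proof.
move=> fl; apply: mlin_sub (mlin_faces fl); split=> [s sz | a] /=; first by rewrite /lmul; lintac.
by apply: (mlin_comp (f := lmul a)) => //; rewrite /lmul; lintac.
Qed.

Lemma lin_insertion V z (F : V -> seq A -> A) s :
  (forall l, size l = (size s).+1 -> lin (fun c => F c l)) -> lin (fun c => insertion z (F c) s).
Proof.
elim: s F => [|a s IH] F h; first by apply: h.
move=> k x y /=; rewrite (h [:: z, a & s]) // (IH (fun c l => F c (a :: l))) => [|l sz].
  by rewrite scalerBr opprD addrACA.
by apply: h; rewrite /= sz.
Qed.

Lemma mlin_insertion z n (f : seq A -> A) : mlin n.+1 f -> mlin n (insertion z f).
Proof.
elim: n f => // n IH f fl; split=> [s sz k x y | a] /=.
  rewrite (proj1 (proj2 fl z)) // (@lin_insertion _ z (fun c l => f (c :: l))) => [|l szl].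
    by rewrite scalerBr opprD addrACA.
  by apply: (proj1 fl); rewrite szl sz.
apply: mlin_sub; last exact: IH (proj2 fl a).
exact: (proj2 (proj2 fl z) a).
Qed.

(** Splitting off the term j = 0 leaves the same expression for g(a, -) on the tail with opposite
    sign, which is the recursion of [faces]. *)
Lemma hdiff_sum n (g : seq A -> A) (s : seq A) : size s = n.+1 ->
  \sum_(j < n) (-1) ^+ j.+1 * g (mergeAt j s) + (-1) ^+ n.+1 * (g (take n s) * nth 0 s n)
  = - faces rmul g s.
Proof.
elim: n g s => [|n IH] g [|a [|b s]] // sz.
  by rewrite big_ord0 add0r expr1 mulN1r.
have {}sz : size (b :: s) = n.+1 by case: sz => <-.
rewrite faces_cons opprB -(opprK (faces _ _ (b :: s))) -(IH _ _ sz).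
rewrite big_ord_recl -addrA addrC opprD -sumrN expr1 mulN1r.
congr (_ + _ - _); last by rewrite /mergeAt /= drop0.
  by apply: eq_bigr => j _; rewrite exprS mulN1r mulNr.
by rewrite exprS mulN1r mulNr.
Qed.

Lemma seqdiffZ k g s : seqdiff act triv (fun l => k *: g l) s = k *: seqdiff act triv g s.
Proof.
have facesZ l : faces triv (fun l => k *: g l) l = k *: faces triv g l.
  elim: l (g) => [|a [|b l] IH] g'; first by rewrite scaler0.
    by rewrite /= /triv !scalerA mulrC.
  by rewrite !faces_cons (IH (fun l => g' (a :: l))) scalerBr.
rewrite /seqdiff facesZ scalerBr; congr (_ - _).
by case: s => [|a s] /=; rewrite ?scaler0 // (linZ _ (lin_act a)).
Qed.

(** * Transfer to cochains and the homotopy *)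

Local Notation frakS' := (frakS D S Sinv R rho).

Lemma cev_frakS n (f : Coch A n) s : size s = n -> cev (frakS' f) s = seqfrakS (cev f) s.
Proof.
have cevDE (l : seq A) x : cevD (iotan rho f) l x = rho (cev f l * x).
  rewrite /cevD /cev mulr_suml (lin_sum _ _ _ lin_rho); apply: eq_bigr => idx _.
  by rewrite ffunE -scalerAl (linZ _ lin_rho).
have ->: frakS' f = tabulate n (seqfrakS (cev f)).
  apply/ffunP => idx; rewrite /frakS /Sn !ffunE; apply: eq_seqS => l sz.
  have szl : size l = n by rewrite sz size_map size_tuple.
  rewrite -[RHS](cev_tabulate _ szl); last exact: mlin_sw3.
  congr (cev _ _); apply/ffunP => idx'; rewrite !ffunE; apply: eq_sw3 => l1 l2 l3 _.
  by apply: eq_Ev2 => q1 q2; rewrite cevDE.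
by apply: cev_tabulate; exact: mlin_sw3.
Qed.

Lemma untwist_frakS n (f : Coch A n) s : size s = n ->
  untwist (cev (frakS' f)) s = fourier (untwist (cev f) s).
Proof.
move=> sz; rewrite -(untwist_seqfrakS (mlin_cev f) sz).
by apply: eq_untwist => l szl; rewrite cev_frakS // szl.
Qed.

Lemma untwist_cevM n c (f : Coch A n) s :
  untwist (cev [ffun idx => c * f idx]) s = c * untwist (cev f) s.
Proof.
rewrite -untwistM; apply: eq_untwist => l _; rewrite /cev mulr_sumr.
by apply: eq_bigr => idx _; rewrite ffunE scalerAr.
Qed.

Lemma lin_untwist_cev n s : lin (fun f : Coch A n => untwist (cev f) s).
Proof. by apply: lin_untwist => l _; exact: cev_lin. Qed.

Lemma untwist_cev_inj n (f g : Coch A n) :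
  (forall s, size s = n -> untwist (cev f) s = untwist (cev g) s) -> f = g.
Proof.
move=> e; apply: cev_inj => s sz; rewrite -(untwistK (mlin_cev f) sz) -(untwistK (mlin_cev g) sz).
by apply: eq_twist => l szl; apply: e; rewrite szl.
Qed.

Lemma untwist_hdiff n (f : Coch A n) s : size s = n.+1 ->
  untwist (cev (hdiff f)) s = seqdiff act triv (untwist (cev f)) s.
Proof.
move=> sz; rewrite -(untwist_seqdiff (mlin_cev f) sz); apply: eq_untwist => l szl.
have -> : hdiff f = tabulate n.+1 (seqdiff lmul rmul (cev f)).
  apply/ffunP => idx; rewrite !ffunE; cbv zeta.
  have : size (Defs.bseq idx) = n.+1 by rewrite size_map size_tuple.
  case: (Defs.bseq idx) => // a r szr; rewrite -addrA (hdiff_sum _ szr).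
  by rewrite /seqdiff /= /lmul.
by apply: cev_tabulate; [exact/mlin_seqdiff/mlin_cev | rewrite szl].
Qed.

(** The homotopy of [seqdiff_insertion] for z = w, scaled by the square of [rhorhoQ] and conjugated
    by [untwist]. *)
Definition homotopy n (f : Coch A n.+1) : Coch A n :=
  tabulate n (twist (fun l => rhorhoQ R rho ^+ 2 *: insertion w (untwist (cev f)) l)).

Lemma homotopy_linear n : linear (@homotopy n).
Proof.
move=> k f g; apply/ffunP => idx; rewrite !ffunE.
apply: (lin_twist (F := fun f l => _ *: insertion w (untwist (cev f)) l)) => l _.
apply: lin_scaler; apply: lin_insertion => l' _; exact: lin_untwist_cev.
Qed.

Lemma untwist_homotopy n (f : Coch A n.+1) s : size s = n ->
  untwist (cev (homotopy f)) s = rhorhoQ R rho ^+ 2 *: insertion w (untwist (cev f)) s.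
Proof.
move=> sz; rewrite -[RHS](@twistK n (fun l => _ *: insertion w (untwist (cev f)) l)) //.
  by apply: eq_untwist => l szl; apply: cev_tabulate; [exact: mlin_twist | rewrite szl].
apply: (mlin_comp (f := fun z => _ *: z)); first by lintac.
exact/mlin_insertion/mlin_untwist.
Qed.

(** Because eps(w) = 1, the identity may be read as the right action [triv w]; this makes the
    difference one between the two actions of the central element w. *)
Lemma untwist_frakS4 n (f : Coch A n) s : size s = n ->
  untwist (cev (frakS' (frakS' (frakS' (frakS' f))) - rhorhoQ R rho ^+ 2 *: f)) s =
  rhorhoQ R rho ^+ 2 *: (act w (untwist (cev f) s) - triv w (untwist (cev f) s)).
Proof.
move=> sz; have hl := @lin_untwist_cev n s.
rewrite addrC -scaleNr hl !untwist_frakS // fourier_pow4 /triv epsw scale1r scalerBr addrC.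
by rewrite scaleNr.
Qed.

Lemma seqdiff_insertion_untwist n (f : Coch A n) s : size s = n ->
  rhorhoQ R rho ^+ 2 *: (act w (untwist (cev f) s) - triv w (untwist (cev f) s)) =
  seqdiff act triv (fun l => rhorhoQ R rho ^+ 2 *: insertion w (untwist (cev f)) l) s +
  rhorhoQ R rho ^+ 2 *: insertion w (untwist (cev (hdiff f))) s.
Proof.
move=> sz; rewrite seqdiffZ -scalerDr.
rewrite (@eq_insertion _ _ _ _ (untwist (cev (hdiff f))) (seqdiff act triv (untwist (cev f)))); last first.
  by move=> l szl; rewrite untwist_hdiff // szl sz.
rewrite seqdiff_insertion //; last exact: wC.
- by move=> a x y; rewrite (linD (lin_act a)) -scaleN1r (linZ _ (lin_act a)) scaleN1r.
- by move=> a x y; rewrite /triv scalerBr.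
Qed.

Lemma frakS_T_frakS n (f : Coch A n) :
  frakS' (frakT v (frakS' f)) = rho v *: frakTinv v (frakS' (frakTinv v f)).
Proof.
apply: untwist_cev_inj => s sz; rewrite (linZ _ (@lin_untwist_cev n s)).
by rewrite untwist_frakS // /frakT /frakTinv !untwist_cevM !untwist_frakS // untwist_cevM fourier_T_fourier.
Qed.

Lemma homotopy0 (f : Coch A 0) :
  frakS' (frakS' (frakS' (frakS' f))) - rhorhoQ R rho ^+ 2 *: f = homotopy (hdiff f).
Proof.
apply: untwist_cev_inj => s sz; rewrite untwist_frakS4 // untwist_homotopy // (seqdiff_insertion_untwist f sz).
(* On the empty sequence [seqdiff] is 0, so only the homotopy after the differential is left. *)
by rewrite (size0nil sz) /seqdiff /= subr0 add0r.
Qed.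

Lemma homotopyS n (f : Coch A n.+1) :
  frakS' (frakS' (frakS' (frakS' f))) - rhorhoQ R rho ^+ 2 *: f =
  hdiff (homotopy f) + homotopy (hdiff f).
Proof.
apply: untwist_cev_inj => s sz; rewrite untwist_frakS4 // (seqdiff_insertion_untwist f sz).
rewrite (linD (@lin_untwist_cev n.+1 s)) untwist_homotopy // untwist_hdiff //; congr (_ + _).
case: s sz => // a s [sz]; rewrite /seqdiff; congr (_ - _).
  by rewrite /= untwist_homotopy.
by apply: eq_faces => l szl; rewrite untwist_homotopy // szl.
Qed.

End Hopf.

Theorem mainTheorem12 (K : fieldType) (A : falgType K)
    (Delta : A -> T2 A) (eps : A -> K) (S Sinv : A -> A) (R : T2 A) (v : A)
    (rho : A -> K) :
  is_Hopf_algebra Delta eps S ->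
  is_inverse_antipode S Sinv ->
  is_quasitriangular Delta R ->
  is_ribbon_element Delta eps S R v ->
  is_factorizable R ->
  is_nonzero_right_integral Delta rho ->
  (* (1) *)
  (forall (n : nat) (f : Coch A n),
     frakS Delta S Sinv R rho (frakT v (frakS Delta S Sinv R rho f))
     = rho v *: frakTinv v (frakS Delta S Sinv R rho (frakTinv v f))) /\
  (* (2) (frakS^n)^4 is cochain homotopic to ((rho(x)rho)(Q))^2 id *)
  (exists h : forall n : nat, Coch A n.+1 -> Coch A n,
     (forall n, linear (h n)) /\
     (forall f : Coch A 0,
        frakS Delta S Sinv R rho (frakS Delta S Sinv R rho
          (frakS Delta S Sinv R rho (frakS Delta S Sinv R rho f)))
        - (rhorhoQ R rho) ^+ 2 *: f
        = h 0%N (hdiff f)) /\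
     (forall (n : nat) (f : Coch A n.+1),
        frakS Delta S Sinv R rho (frakS Delta S Sinv R rho
          (frakS Delta S Sinv R rho (frakS Delta S Sinv R rho f)))
        - (rhorhoQ R rho) ^+ 2 *: f
        = hdiff (h n f) + h n.+1 (hdiff f))).
Proof.
move=> HH HI HQ HR HF Hrho; split.
  by move=> n f; apply: (frakS_T_frakS HH HI HQ HR HF Hrho).
exists (@homotopy K A Delta Sinv R v rho); split; first exact: homotopy_linear.
split; first exact: (homotopy0 HH HI HQ HR HF Hrho).
exact: (homotopyS HH HI HQ HR HF Hrho).
Qed.
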